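(* Let $d \ge 2$ and $k \ge 1$ be integers, let $E \subset \mathbb{R}^d$ be a compact set, and define $$ \Delta_k(E) = \left\{ \left(|x^1-x^2|, |x^2-x^3|, \dots, |x^k-x^{k+1}|\right) : x^1, \dots, x^{k+1} \in E \right\} \subset \mathbb{R}^k. $$ Suppose that the Hausdorff dimension of $E$ is greater than $\frac{d+1}{2}$. Then $\mathcal{L}^k(\Delta_k(E)) > 0$.
   Context: $\mathcal{L}^k$ denotes $k$-dimensional Lebesgue measure, and $|\cdot|$ is the Euclidean norm on $\mathbb{R}^d$. *)

(* Defs.v *)
From HB Require Import structures.
From mathcomp Require Import all_boot all_order all_algebra.
From mathcomp Require Import all_classical all_reals all_analysis.

Set Implicit Arguments.
Unset Strict Implicit.
Unset Printing Implicit Defensive.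
Import Order.TTheory GRing.Theory Num.Theory.
Import numFieldNormedType.Exports.
Local Open Scope classical_set_scope.
Local Open Scope ring_scope.

(* R^d is 'rV[R]_d.  The library's norm on row vectors is the sup norm, so the
   Euclidean norm is defined here; both induce the same topology, hence the same
   compact sets. *)
Definition enorm {R : realType} {d : nat} (x : 'rV[R]_d) : R :=
  Num.sqrt (\sum_(i < d) x ord0 i ^+ 2).

Section hausdorff.
Local Open Scope ereal_scope.
Context {R : realType} {d : nat}.
Implicit Types (E U : set 'rV[R]_d) (s delta : R).

(* This is -oo when U is empty. *)
Definition ediam U : \bar R :=
  ereal_sup [set (enorm (p.1 - p.2))%:E | p in U `*` U].

(* The usual convention diam(set0)^s = 0 also for s = 0, whereas a point
   contributes 0^0 = 1 (powR 0 0 = 1), so that H^0 is the counting measure. *)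
Definition ediam_pow s U : \bar R :=
  if U == set0 then 0 else poweR (ediam U) s.

Definition hausdorff_premeasure s delta E : \bar R :=
  ereal_inf [set \sum_(i <oo) ediam_pow s (U i) |
    U in [set U : (set 'rV[R]_d)^nat |
      E `<=` \bigcup_i U i /\ forall i, ediam (U i) <= delta%:E]].

(* The premeasure is nonincreasing in delta: the supremum is the limit at 0. *)
Definition hausdorff_measure s E : \bar R :=
  ereal_sup [set hausdorff_premeasure s delta E | delta in [set t | (0 < t)%R]].

Definition hausdorff_dim E : \bar R :=
  ereal_inf [set s%:E | s in [set s | (0 <= s)%R /\ hausdorff_measure s E = 0]].

End hausdorff.

Section cons_measure.
Local Open Scope ereal_scope.
Context {R : realType} {disp : measure_display} {T : measurableType disp} {n : nat}.
Variable m1 : {sigma_finite_measure set T -> \bar R}.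
Variable m2 : {sigma_finite_measure set (n.-tuple T) -> \bar R}.

Definition tuple_cons (p : T * n.-tuple T) : n.+1.-tuple T :=
  [tuple of p.1 :: p.2].

Lemma measurable_tuple_cons : measurable_fun setT tuple_cons.
Proof. exact: measurable_cons. Qed.

Definition cons_measure : set (n.+1.-tuple T) -> \bar R :=
  pushforward (m1 \x m2) tuple_cons.

Let cm0 : cons_measure set0 = 0.
Proof. by rewrite /cons_measure /pushforward preimage_set0 measure0. Qed.

Let cm_ge0 A : 0 <= cons_measure A.
Proof. by rewrite /cons_measure /pushforward measure_ge0. Qed.

Let cm_sigma_additive : semi_sigma_additive cons_measure.
Proof.
pose m : {measure set _ -> \bar R} := m1 \x m2.
move=> F mF tF mUF; rewrite /cons_measure /pushforward preimage_bigcup.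
have mpre A : measurable A -> measurable (tuple_cons @^-1` A).
  by move=> mA; rewrite -[X in measurable X]setTI; exact: measurable_tuple_cons.
apply: (@measure_semi_sigma_additive _ _ _ m).
- by move=> i; exact: mpre.
- apply/trivIsetP => /= i j _ _ ij; rewrite -preimage_setI.
  by move/trivIsetP : tF => /(_ _ _ _ _ ij) ->//; rewrite preimage_set0.
- by rewrite -preimage_bigcup; exact: mpre.
Qed.

HB.instance Definition _ := isMeasure.Build _ _ _ cons_measure
  cm0 cm_ge0 cm_sigma_additive.

Let uncons (t : n.+1.-tuple T) : T * n.-tuple T := (thead t, [tuple of behead t]).

Let tuple_consK : cancel tuple_cons uncons.
Proof.
by move=> [x t]; rewrite /uncons /tuple_cons theadE; congr pair; exact/val_inj.
Qed.

Let cm_sigma_finite : sigma_finite setT cons_measure.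
Proof.
have [F FT Foo] : sigma_finite setT (m1 \x m2).
  have /sigma_finiteP[F [TF ndF Foo]] := sigma_finiteT m1.
  have /sigma_finiteP[G [TG ndG Goo]] := sigma_finiteT m2.
  exists (fun n => F n `*` G n).
    rewrite -setXTT TF TG predeqE => -[x y]; split.
      move=> [/= [i _ Fix] [j _ Gjy]]; exists (maxn i j) => //; split.
      - by move: x Fix; exact/subsetPset/ndF/leq_maxl.
      - by move: y Gjy; exact/subsetPset/ndG/leq_maxr.
    by move=> [i _ []/= ? ?]; split; exists i.
  move=> i; have [? ?] := Foo i; have [? ?] := Goo i.
  split; first exact: measurableX.
  by rewrite product_measure1E// lte_mul_pinfty// ge0_fin_numE.
have muncons : measurable_fun setT uncons.
  by apply/measurable_fun_pairP; split;
    [exact: measurable_tnth | exact: measurable_behead].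
exists (fun i => uncons @^-1` F i).
  by rewrite -preimage_bigcup -FT preimage_setT.
move=> i; have [mF Fi] := Foo i; split.
  by rewrite -[X in measurable X]setTI; exact: muncons.
rewrite /cons_measure /pushforward (_ : _ @^-1` _ = F i)//.
by rewrite -comp_preimage (_ : uncons \o _ = id)//; apply/funext; exact: tuple_consK.
Qed.

HB.instance Definition _ := Measure_isSigmaFinite.Build _ _ _ cons_measure
  cm_sigma_finite.

End cons_measure.

(* Lebesgue measure on the Borel sets of R^k (the measurable sets of
   k.-tuple (measurableTypeR R)), as the k-fold product of the
   one-dimensional Lebesgue measure. *)
Fixpoint lebesgue_tuple {R : realType} (k : nat) :
    {sigma_finite_measure set (k.-tuple (measurableTypeR R)) -> \bar R} :=
  match k with
  | 0 => dirac [tuple]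
  | n.+1 => cons_measure lebesgue_measure (lebesgue_tuple n)
  end.

Lemma lebesgue_tupleE (R : realType) (k : nat) (A : 'I_k -> set (measurableTypeR R)) :
  (forall i, measurable (A i)) ->
  lebesgue_tuple k [set t | forall i, A i (tnth t i)] =
  (\prod_(i < k) lebesgue_measure (A i))%E.
Proof.
elim: k A => [|n IHn] A mA /=.
  rewrite big_ord0 /dirac indicE mem_set//=; first by case.
rewrite big_ord_recl -IHn; last by move=> i; exact: mA.
have mB : measurable [set t : n.-tuple (measurableTypeR R) |
    forall i, A (lift ord0 i) (tnth t i)].
  rewrite (_ : [set _ | _] = \bigcap_(i in [set: 'I_n])
      ((@tnth n (measurableTypeR R))^~ i @^-1` A (lift ord0 i))); last first.
    by apply/seteqP; split => t /= h i; [move=> _|]; exact: h.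
  apply: fin_bigcap_measurable => [|i _]; first exact: finite_finset.
  by rewrite -[X in measurable X]setTI; exact: measurable_tnth.
rewrite -product_measure1E// /cons_measure /pushforward; congr (_ _).
apply/seteqP; split => -[x t] /=.
  move=> h; split; first exact: (h ord0).
  by move=> i; have := h (lift ord0 i); rewrite tnthS.
move=> [h0 h] i; case: (unliftP ord0 i) => [j ->|->]; last exact: h0.
by rewrite tnthS; exact: h.
Qed.

(* Points x^1, ..., x^(k+1) of E are indexed from 0; inord i and inord i.+1 are
   the elements of 'I_k.+1 with values i and i.+1. *)
Definition chain_distances {R : realType} {d : nat} (k : nat) (E : set 'rV[R]_d) :
    set (k.-tuple (measurableTypeR R)) :=
  [set [tuple enorm (x (inord i) - x (inord i.+1)) | i < k] |
    x in [set x : 'I_k.+1 -> 'rV[R]_d | forall i, E (x i)]].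
Arguments chain_distances {R d} k E.

(* Main.v *)
Require Import Defs.
From mathcomp Require Import all_boot all_order all_algebra.
From mathcomp Require Import all_classical all_reals all_analysis.
From mathcomp Require Import ring lra zify.
From mathcomp Require Import complex.
Import Order.TTheory GRing.Theory Num.Theory.
Import numFieldNormedType.Exports.
Local Open Scope classical_set_scope.
Local Open Scope ring_scope.

(** Averaging over all distances replaces the usual decay estimates for the
    Fourier transform of spherical measures, and everything takes place on
    finite sets of points.

    Fix s > (d+1)/2 below the dimension of E.  At every scale 2^-l there is a
    finite set X of points of E with weights w of total mass at least c, whose
    mass in each dyadic cube of side 2^-j, j <= l, is at most A 2^-(js); the
    constants A and c do not depend on l ([discrete_frostman]).  Let T_j f (y)
    be the sum of w_x f_x over the points x whose distance to y lies in
    [j 2^-l, (j+1) 2^-l).  The heart of the proof is that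
      sum_j |T_j f|^2 <= C 2^-l |f|^2  in l^2(w), with C independent of l
    ([collision_bound]).  Applied k times to T_(j_1) ... T_(j_k) 1, it shows
    with the Cauchy-Schwarz inequality that the chains in X realise at least
    c' 2^(lk) vectors of rounded distances ([many_realised]).  So for every l
    the union of the dyadic cells of side 2^-l that meet Delta_k(E) has measure
    at least c'.  As E is compact, Delta_k(E) is closed and these unions
    decrease to it; hence its measure is at least c' ([lebesgue_tuple_ge]).

    The left side of the collision bound is a sum over triples with
    |x-y| close to |x'-y|.  It is dominated by the Fejer kernel evaluated at
    |x-y|^2 - |x'-y|^2, hence by the average over |n| < 2^l of
      sum_y w_y |sum_x w_x f_x exp(i n eta |x-y|^2)|^2.
    Squaring the distance makes the phase bilinear: up to unimodular factors
    that depend on x alone or on y alone, it is exp(-2 i n eta x.y).  So a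
    bound of order n^(d-2s) is needed for the squared norm of this Fourier
    matrix on l^2(w).  It is a large sieve inequality.  If n is about 2^j, then
    y can be replaced by a corner of its dyadic cube of side 2^-j: the
    correction is absorbed by a Taylor expansion in x.(y - corner), whose terms
    separate the variables ([l2_bounded_cosD]).  For points y on a grid, a
    Fejer majorant and Schur's test bound the squared norm by the number 2^(jd)
    of grid points times the square of the largest cube mass 2^-(js)
    ([grid_bound]).  The sum over n of n^(d-2s) converges exactly because
    s > (d+1)/2. *)

(** * The Fejer kernel *)

Section trig.
Variable R : realType.
Implicit Types (t x y : R) (L : nat).

Lemma sqr_sin_le x : sin x ^+ 2 <= x ^+ 2.
Proof.
wlog x0 : x / 0 <= x => [hw|].
  have [|/ltW x0] := leP 0 x; first exact: hw.
  by rewrite -sqrrN -sinN -[leRHS]sqrrN; apply: hw; rewrite oppr_ge0.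
have [c _] := @MVT_segment R sin cos 0 x x0 (fun y _ => is_derive_sin y)
  (continuous_subspaceT (@continuous_sin R)).
by rewrite sin0 !subr0 => ->; rewrite exprMn ler_piMl ?sqr_ge0.
Qed.

Lemma cos_half x : cos x = 1 - 2 * sin (x / 2) ^+ 2.
Proof.
have {1}-> : x = (x / 2) *+ 2 by rewrite mulr2n; field.
by rewrite cos_mulr2n cos2sin2 !mulr2n; ring.
Qed.

Lemma cos_ge_quadratic x : 1 - x ^+ 2 / 2 <= cos x.
Proof. by rewrite cos_half; have := sqr_sin_le (x / 2); lra. Qed.

Lemma sin_ge_half x : 0 <= x <= 1 -> x / 2 <= sin x.
Proof.
move=> /andP[x0 x1].
have [c] := @MVT_segment R sin cos 0 x x0 (fun y _ => is_derive_sin y)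
  (continuous_subspaceT (@continuous_sin R)).
rewrite in_itv/= => /andP[c0 cx]; rewrite sin0 !subr0 => ->.
have := cos_ge_quadratic c; nra.
Qed.

(** Written as a sum over pairs, which makes it the squared modulus of the sum of
    exp(iat) over a < L. *)
Definition fejer L t : R := \sum_(a < L) \sum_(b < L) cos (t * (a%:R - b%:R)).

Lemma sum_cosB (I : finType) (g al : I -> R) :
  \sum_x \sum_y g x * g y * cos (al x - al y) =
  (\sum_x g x * cos (al x)) ^+ 2 + (\sum_x g x * sin (al x)) ^+ 2.
Proof.
rewrite !expr2 !big_distrlr/= -big_split/=; apply: eq_bigr => x _.
rewrite -big_split/=; apply: eq_bigr => y _.
by rewrite cosB; ring.
Qed.

Lemma fejerE L t : fejer L t =
  (\sum_(a < L) cos (t * a%:R)) ^+ 2 + (\sum_(a < L) sin (t * a%:R)) ^+ 2.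
Proof.
have := @sum_cosB 'I_L (fun=> 1) (fun a => t * a%:R).
under [in X in _ = X -> _]eq_bigr do rewrite mul1r.
under [in X in _ = _ + X ^+ _ -> _]eq_bigr do rewrite mul1r.
move=> <-; apply: eq_bigr => a _; apply: eq_bigr => b _.
by rewrite mulr1 mul1r mulrBr.
Qed.

Lemma fejer_ge0 L t : 0 <= fejer L t.
Proof. by rewrite fejerE addr_ge0 ?sqr_ge0. Qed.

Lemma fejerN L t : fejer L (- t) = fejer L t.
Proof.
by apply: eq_bigr => a _; apply: eq_bigr => b _; rewrite mulNr cosN.
Qed.

Lemma fejer_le L t : fejer L t <= L%:R ^+ 2.
Proof.
rewrite /fejer; apply: (@le_trans _ _ (\sum_(a < L) \sum_(b < L) 1)).
  by apply: ler_sum => a _; apply: ler_sum => b _; exact: cos_le1.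
by rewrite sumr_const card_ord sumr_const card_ord -[leLHS]mulr_natr -expr2 lexx.
Qed.

(** Near the origin every term of the geometric sum has real part at least 1/2. *)
Lemma fejer_lower L t : L%:R * `|t| <= 1 -> L%:R ^+ 2 / 4 <= fejer L t.
Proof.
move=> h; rewrite fejerE.
have : L%:R / 2 <= \sum_(a < L) cos (t * a%:R).
  apply: (@le_trans _ _ (\sum_(a < L) (1 / 2))).
    by rewrite sumr_const card_ord mul1r -[leRHS]mulr_natl lexx.
  apply: ler_sum => a _.
  have := cos_ge_quadratic (t * a%:R).
  have : `|t * a%:R| <= 1.
    rewrite normrM mulrC; apply: le_trans h; rewrite ler_wpM2r//.
    by rewrite ger0_norm// ler_nat ltnW.
  move=> h1; have : (t * a%:R) ^+ 2 <= 1.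
    by rewrite -real_normK ?num_real// expr_le1.
  lra.
move=> h1; have := sqr_ge0 (\sum_(a < L) sin (t * a%:R)).
have L0 : 0 <= L%:R :> R by [].
nra.
Qed.

(** The geometric sum, multiplied by exp(it) - 1, telescopes; these are the squared
    moduli, as |exp(it) - 1|^2 = 2 - 2 cos t. *)
Lemma fejer_closed L t : fejer L t * (2 - 2 * cos t) = 2 - 2 * cos (L%:R * t).
Proof.
pose C := \sum_(a < L) cos (t * a%:R); pose S := \sum_(a < L) sin (t * a%:R).
have hC : (cos t - 1) * C - sin t * S = cos (L%:R * t) - 1.
  rewrite /C /S; elim: (L) => [|n IH].
    by rewrite !big_ord0 mul0r cos0; ring.
  rewrite !big_ord_recr/= !mulrDr opprD addrACA IH -natr1 (mulrDl n%:R) mul1r.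
  rewrite (mulrC t n%:R) cosD; ring.
have hS : (cos t - 1) * S + sin t * C = sin (L%:R * t).
  rewrite /C /S; elim: (L) => [|n IH].
    by rewrite !big_ord0 mul0r sin0; ring.
  rewrite !big_ord_recr/= !mulrDr addrACA IH -natr1 (mulrDl n%:R) mul1r.
  rewrite (mulrC t n%:R) sinD; ring.
rewrite fejerE -/C -/S.
have e1 : cos t ^+ 2 + sin t ^+ 2 = 1 by exact: cos2Dsin2.
have e2 : cos (L%:R * t) ^+ 2 + sin (L%:R * t) ^+ 2 = 1 by exact: cos2Dsin2.
transitivity ((cos (L%:R * t) - 1) ^+ 2 + sin (L%:R * t) ^+ 2).
  rewrite -hC -hS; transitivity ((C ^+ 2 + S ^+ 2) * (cos t ^+ 2 + sin t ^+ 2 + 1 - 2 * cos t)).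
    by rewrite e1; ring.
  ring.
transitivity (cos (L%:R * t) ^+ 2 + sin (L%:R * t) ^+ 2 + 1 - 2 * cos (L%:R * t)).
  by ring.
by rewrite e2; ring.
Qed.

Lemma fejer_upper L t : `|t| <= 1 -> t ^+ 2 * fejer L t <= 16.
Proof.
wlog t0 : t / 0 <= t => [hw|].
  have [|/ltW t0 t1] := leP 0 t; first exact: hw.
  by rewrite -sqrrN -fejerN; apply: hw; rewrite ?oppr_ge0// normrN.
rewrite ger0_norm// => t1.
have : t ^+ 2 / 4 <= 2 - 2 * cos t.
  have h := @sin_ge_half (t / 2).
  have : t / 2 / 2 <= sin (t / 2) by apply: h; apply/andP; split; lra.
  rewrite cos_half; nra.
have := fejer_closed L t; have := cos_geN1 (L%:R * t).
have := fejer_ge0 L t; nra.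
Qed.

Local Open Scope complex_scope.
(** In several variables exp(i sum_k th_k n_k) is a product, so the sum over the box
    factors.  The factors are real because n = a - b is symmetric about 0. *)
Lemma prod_fejer d L (th : 'I_d -> R) :
  \sum_(f : {ffun 'I_d -> 'I_L * 'I_L})
     cos (\sum_i th i * ((f i).1%:R - (f i).2%:R)) = \prod_i fejer L (th i).
Proof.
pose e (t : R) : R[i] := cos t +i* sin t.
have eD (s t : R) : e (s + t) = e s * e t.
  by rewrite /e cosD sinD; apply/eqP; rewrite eq_complex/= eqxx addrC !eqxx.
have e0 : e 0 = 1 by rewrite /e cos0 sin0.
have eS (I : finType) (g : I -> R) : e (\sum_i g i) = \prod_i e (g i).
  by apply: (big_morph e eD e0).
have h i : \sum_(q : 'I_L * 'I_L) e (th i * (q.1%:R - q.2%:R)) = (fejer L (th i))%:C.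
  have es (I : finType) (g : I -> R) :
      \sum_i e (g i) = (\sum_i cos (g i)) +i* (\sum_i sin (g i)).
    apply: (big_ind3 (fun (a : R[i]) b c => a = b +i* c)) => //.
    by move=> ? ? ? ? ? ? -> ->.
  rewrite es -(pair_bigA _ (fun a b : 'I_L => cos (th i * (a%:R - b%:R))))/=.
  rewrite -(pair_bigA _ (fun a b : 'I_L => sin (th i * (a%:R - b%:R))))/=.
  rewrite [X in _ +i* X](_ : _ = 0)//.
  set s := (X in X = _); suff : s = - s by lra.
  rewrite {1}/s exchange_big/= -sumrN; apply: eq_bigr => a _.
  rewrite -sumrN; apply: eq_bigr => b _.
  by rewrite -sinN -mulrN opprB.
have : \prod_i \sum_(q : 'I_L * 'I_L) e (th i * (q.1%:R - q.2%:R)) =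
    \sum_(f : {ffun 'I_d -> 'I_L * 'I_L}) \prod_i e (th i * ((f i).1%:R - (f i).2%:R)).
  exact: bigA_distr_bigA.
rewrite (eq_bigr (fun i => (fejer L (th i))%:C)) => [|i _]; last exact: h.
rewrite -rmorph_prod => /(congr1 (@complex.Re R)) /= ->.
by rewrite raddf_sum; apply: eq_bigr => f _; rewrite -eS.
Qed.

End trig.

(** * A large sieve inequality on a grid *)

Section grid.
Variable R : realType.

(** Schur's test, from 2 |c_x c_y| <= c_x^2 + c_y^2 and the symmetry of P. *)
Lemma schur_test (X : finType) (w c : X -> R) (P : X -> X -> R) (B : R) :
  (forall x, 0 <= w x) -> (forall x y, 0 <= P x y) ->
  (forall x y, P x y = P y x) ->
  (forall x, \sum_y w y * P x y <= B) ->
  \sum_x \sum_y (w x * c x) * (w y * c y) * P x y <= B * \sum_x w x * c x ^+ 2.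
Proof.
move=> w0 P0 Psym hB.
pose T x y := w x * w y * P x y * (c x ^+ 2 / 2).
apply: (@le_trans _ _ (\sum_x \sum_y (T x y + T y x))).
  apply: ler_sum => x _; apply: ler_sum => y _.
  rewrite (_ : T x y + T y x = w x * w y * P x y * ((c x ^+ 2 + c y ^+ 2) / 2)).
    2: by rewrite /T (Psym y x); field.
  rewrite [leLHS](_ : _ = w x * w y * P x y * (c x * c y)); last by ring.
  apply: ler_wpM2l; first by rewrite !mulr_ge0.
  have := sqr_ge0 (c x - c y); rewrite sqrrB mulr2n; lra.
under eq_bigr do rewrite big_split/=.
rewrite big_split/= [X in _ + X]exchange_big/=.
rewrite -big_split/= mulr_sumr; apply: ler_sum => x _.
have -> : \sum_y T x y = (\sum_y w y * P x y) * (w x * (c x ^+ 2 / 2)).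
  by rewrite mulr_suml; apply: eq_bigr => y _; rewrite /T; ring.
have -> : B * (w x * c x ^+ 2) = B * (w x * (c x ^+ 2 / 2)) + B * (w x * (c x ^+ 2 / 2)).
  by field.
by apply: lerD; apply: ler_wpM2r; rewrite ?hB// mulr_ge0// divr_ge0// sqr_ge0.
Qed.

Definition ndist (a b : nat) : nat := (a - b + (b - a))%N.

(** The large sieve on a grid.  The sum over y is first enlarged to all grid points
    m_y, each with the largest cell mass mu.  Then every m is written as a - b with
    a, b in a box of side 2M, in at least M^d ways; the sum over all such pairs is
    a product of Fejer kernels by [prod_fejer], to which Schur's test applies.  The
    weights enter a second time, again through the mass of the cells, because the
    Fejer kernels are controlled by the cell indices alone. *)
Lemma grid_bound (X : finType) (d M : nat) (w : X -> R)
    (m : X -> {ffun 'I_d -> 'I_M}) (xi : X -> 'I_d -> R) (kap : nat -> R)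
    (S mu : R) :
  (forall x, 0 <= w x) -> (forall n, 0 <= kap n) ->
  (forall v, \sum_(y | m y == v) w y <= mu) ->
  (forall x y i, fejer R (M + M) (xi x i - xi y i) <= kap (ndist (m x i) (m y i))) ->
  (forall k0 : 'I_M, \sum_(k < M) kap (ndist k0 k) <= S) ->
  forall c : X -> R,
  M%:R ^+ d * (\sum_y w y *
    ((\sum_x w x * c x * cos (\sum_i xi x i * (m y i)%:R)) ^+ 2 +
     (\sum_x w x * c x * sin (\sum_i xi x i * (m y i)%:R)) ^+ 2))
  <= mu ^+ 2 * S ^+ d * \sum_x w x * c x ^+ 2.
Proof.
move=> w0 kap0 hmu hfej hS c.
have mu0 (v : {ffun 'I_d -> 'I_M}) : 0 <= mu.
  by apply: le_trans (hmu v); apply: sumr_ge0.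
have [x0 _|X0] := pickP (predT : pred X); last first.
  by rewrite !big1 ?mulr0// => x _; have := X0 x.
have {}mu0 := mu0 (m x0).
pose Phi (v : 'I_d -> R) := (\sum_x w x * c x * cos (\sum_i xi x i * v i)) ^+ 2 +
     (\sum_x w x * c x * sin (\sum_i xi x i * v i)) ^+ 2.
have Phi0 v : 0 <= Phi v by rewrite addr_ge0 ?sqr_ge0.
pose F := {ffun 'I_d -> 'I_(M + M) * 'I_(M + M)}.
pose df (f : F) i : R := (f i).1%:R - (f i).2%:R.
have hlt (a b : 'I_M) : (a + b < M + M)%N.
  by have := ltn_ord a; have := ltn_ord b; lia.
have hlt2 (b : 'I_M) : (b < M + M)%N.
  by have := ltn_ord b; lia.
(* the M^d representations of m y as a difference of points of the larger box *)
pose h (y : X) (b : {ffun 'I_d -> 'I_M}) : F :=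
  [ffun i => (Ordinal (hlt (b i) (m y i)), Ordinal (hlt2 (b i)))].
have Phih y b : Phi (df (h y b)) = Phi (fun i => (m y i)%:R).
  congr Phi; apply/funext => i; rewrite /df ffunE/= natrD; ring.
have step1 : M%:R ^+ d * (\sum_y w y * Phi (fun i => (m y i)%:R)) <=
    mu * \sum_(f : F) Phi (df f).
  have -> : M%:R ^+ d * (\sum_y w y * Phi (fun i => (m y i)%:R)) =
      \sum_y \sum_(b : {ffun 'I_d -> 'I_M}) w y * Phi (df (h y b)).
    rewrite mulr_sumr; apply: eq_bigr => y _.
    under eq_bigr do rewrite Phih.
    by rewrite sumr_const card_ffun !card_ord -[RHS]mulr_natl natrX.
  rewrite pair_big/= (partition_big (fun q => h q.1 q.2) predT)//=.
  rewrite mulr_sumr; apply: ler_sum => f _.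
  rewrite (eq_bigr (fun q => w q.1 * Phi (df f))); last first.
    by move=> q /eqP ->.
  rewrite -mulr_suml; apply: ler_wpM2r => //.
  have [q0 hq0|no] := pickP (fun q : X * {ffun 'I_d -> 'I_M} => h q.1 q.2 == f); last first.
    by rewrite big_pred0.
  have hq q : h q.1 q.2 = f -> q.2 = q0.2 /\ m q.1 = m q0.1.
    move=> e; have e' := etrans e (esym (eqP hq0)).
    have e2 : q.2 = q0.2.
      apply/ffunP => i; apply: val_inj.
      by have /(congr1 (fun z => val z.2)) := congr1 (fun f : F => f i) e'; rewrite !ffunE.
    split => //; apply/ffunP => i; apply: val_inj.
    have /(congr1 (fun z => val z.1)) := congr1 (fun f : F => f i) e'.
    by rewrite !ffunE /= e2 => /addnI.
  apply: le_trans (hmu (m q0.1)).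
  rewrite -(pair_big_dep predT (fun x b => h x b == f) (fun x b => w x))/=.
  rewrite [leRHS]big_mkcond/=; apply: ler_sum => y _.
  case: ifPn => hy.
    apply: (@le_trans _ _ (\sum_(b | b == q0.2) w y)); last by rewrite big_pred1_eq.
    rewrite [leLHS]big_mkcond [leRHS]big_mkcond/=; apply: ler_sum => b _.
    by case: ifPn => [/eqP/(hq (y, b))[/= -> _]|_]; rewrite ?eqxx//; case: ifP.
  rewrite big_pred0// => b; apply/negbTE; apply: contra hy => /eqP/(hq (y, b))[_ /= ->].
  by rewrite eqxx.
apply: (le_trans step1).
rewrite expr2 -!mulrA; apply: ler_wpM2l => //; rewrite mulrA.
pose P x y := \prod_i fejer R (M + M) (xi x i - xi y i).
have -> : \sum_(f : F) Phi (df f) =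
   \sum_x \sum_y (w x * c x) * (w y * c y) * P x y.
  under eq_bigr do rewrite /Phi -(@sum_cosB R X (fun x => w x * c x)).
  rewrite exchange_big/=; apply: eq_bigr => x _.
  rewrite exchange_big/=; apply: eq_bigr => y _.
  rewrite -mulr_sumr; congr (_ * _).
  rewrite /P -prod_fejer; apply: eq_bigr => f _; congr cos.
  by rewrite -sumrB; apply: eq_bigr => i _; rewrite mulrBl.
apply: schur_test => //.
- by move=> x y; apply: prodr_ge0 => i _; exact: fejer_ge0.
- by move=> x y; apply: eq_bigr => i _; rewrite -fejerN opprB.
move=> x.
rewrite (partition_big m predT)//=.
apply: (@le_trans _ _ (\sum_(v : {ffun 'I_d -> 'I_M}) mu * \prod_i kap (ndist (m x i) (v i)))).
  apply: ler_sum => v _.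
  apply: (@le_trans _ _ (\sum_(y | m y == v) w y * \prod_i kap (ndist (m x i) (v i)))).
    apply: ler_sum => y /eqP <-; apply: ler_wpM2l => //.
    by apply: ler_prod => i _; rewrite fejer_ge0 hfej.
  rewrite -mulr_suml; apply: ler_wpM2r => //; exact: prodr_ge0.
rewrite -mulr_sumr; apply: ler_wpM2l => //.
rewrite -(bigA_distr_bigA (fun i (k : 'I_M) => kap (ndist (m x i) k)))/=.
have -> : S ^+ d = \prod_(i < d) S by rewrite prodr_const card_ord.
by apply: ler_prod => i _; rewrite hS andbT; exact: sumr_ge0.
Qed.

End grid.

(** * Matrices acting on weighted l^2 spaces *)

Section bnd.
Variables (R : realType) (X : finType) (w : X -> R).
Hypothesis w0 : forall x, 0 <= w x.
Implicit Types (A : X -> X -> R) (B : R).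

(** The matrix A maps l^2(w) to itself with squared norm at most B. *)
Definition l2_bounded A B := forall c : X -> R,
  \sum_y w y * (\sum_x w x * c x * A y x) ^+ 2 <= B * \sum_x w x * c x ^+ 2.

Lemma sqr_sum_le (n : nat) (al u : 'I_n -> R) :
  (\sum_k al k * u k) ^+ 2 <= (\sum_k `|al k|) * \sum_k `|al k| * u k ^+ 2.
Proof.
pose T i j := `|al i| * (`|al j| * (u j ^+ 2 / 2)).
rewrite expr2 big_distrlr/=.
apply: (@le_trans _ _ (\sum_i \sum_j (T i j + T j i))).
  apply: ler_sum => i _; apply: ler_sum => j _.
  apply: le_trans (ler_norm _) _; rewrite !normrM.
  have -> : T i j + T j i = `|al i| * `|al j| * ((u i ^+ 2 + u j ^+ 2) / 2).
    by rewrite /T; field.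
  have -> : `|al i| * `|u i| * (`|al j| * `|u j|) = `|al i| * `|al j| * (`|u i| * `|u j|) by ring.
  apply: ler_wpM2l; first by rewrite mulr_ge0.
  have := sqr_ge0 (`|u i| - `|u j|); rewrite sqrrB !real_normK ?num_real// mulr2n; lra.
rewrite (eq_bigr (fun i => \sum_j T i j + \sum_j T j i)) => [|i _]; last exact: big_split.
rewrite big_split/= [X in _ + X]exchange_big/=.
have -> : \sum_i \sum_j T i j = (\sum_k `|al k|) * (\sum_k `|al k| * u k ^+ 2) / 2.
  by rewrite -mulrA !mulr_suml; apply: eq_bigr => i _;
     rewrite mulr_sumr; apply: eq_bigr => j _; rewrite /T; ring.
by rewrite -splitr.
Qed.

Lemma l2_bounded_comb (n : nat) (al : 'I_n -> R) (A : 'I_n -> X -> X -> R) B :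
  (forall k, l2_bounded (A k) B) ->
  l2_bounded (fun y x => \sum_k al k * A k y x) ((\sum_k `|al k|) ^+ 2 * B).
Proof.
move=> hA c; set s := \sum_k `|al k|.
have s0 : 0 <= s by apply: sumr_ge0.
apply: (@le_trans _ _ (\sum_y w y * (s * \sum_k `|al k| * (\sum_x w x * c x * A k y x) ^+ 2))).
  apply: ler_sum => y _; apply: ler_wpM2l => //.
  rewrite [X in X ^+ 2](_ : _ = \sum_k al k * (\sum_x w x * c x * A k y x)).
    exact: sqr_sum_le.
  under eq_bigr do rewrite mulr_sumr.
  rewrite exchange_big/=; apply: eq_bigr => k _; rewrite mulr_sumr.
  by apply: eq_bigr => x _; ring.
have -> : \sum_y w y * (s * (\sum_k `|al k| * (\sum_x w x * c x * A k y x) ^+ 2)) =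
    s * \sum_k `|al k| * (\sum_y w y * (\sum_x w x * c x * A k y x) ^+ 2).
  under eq_bigr do rewrite mulrCA.
  rewrite -mulr_sumr; congr (_ * _).
  under eq_bigr do rewrite mulr_sumr.
  rewrite exchange_big/=; apply: eq_bigr => k _; rewrite mulr_sumr.
  by apply: eq_bigr => x _; ring.
rewrite expr2 -!mulrA; apply: ler_wpM2l => //.
by rewrite /s mulr_suml; apply: ler_sum => k _; apply: ler_wpM2l => //; exact: hA.
Qed.

Lemma sum_wsqr_ge0 (c : X -> R) : 0 <= \sum_x w x * c x ^+ 2.
Proof. by apply: sumr_ge0 => x _; rewrite mulr_ge0// sqr_ge0. Qed.

(** Factors that depend on one variable alone are diagonal matrices, of norm at most 1. *)
Lemma l2_bounded_diag A B (v t : X -> R) : 0 <= B ->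
  (forall y, `|v y| <= 1) -> (forall x, `|t x| <= 1) ->
  l2_bounded A B -> l2_bounded (fun y x => v y * A y x * t x) B.
Proof.
move=> B0 v1 t1 hA c.
have sq1 (a : R) : `|a| <= 1 -> a ^+ 2 <= 1.
  by move=> a1; rewrite -real_normK ?num_real// expr_le1.
apply: (@le_trans _ _ (\sum_y w y * (\sum_x w x * (c x * t x) * A y x) ^+ 2)).
  apply: ler_sum => y _; apply: ler_wpM2l => //.
  rewrite [X in X ^+ 2](_ : _ = v y * (\sum_x w x * (c x * t x) * A y x)).
    by rewrite exprMn ler_piMl ?sqr_ge0// sq1.
  by rewrite mulr_sumr; apply: eq_bigr => x _; ring.
apply: le_trans (hA _) _; apply: ler_wpM2l => //.
apply: ler_sum => x _; apply: ler_wpM2l => //.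
by rewrite exprMn ler_piMr ?sqr_ge0// sq1.
Qed.

Lemma l2_bounded_le A B B' : B <= B' -> l2_bounded A B -> l2_bounded A B'.
Proof.
move=> BB hA c; apply: le_trans (hA c) _.
by apply: ler_wpM2r => //; exact: sum_wsqr_ge0.
Qed.

Lemma l2_bounded_eq A A' B : (forall y x, A y x = A' y x) ->
  l2_bounded A B -> l2_bounded A' B.
Proof. by move=> AA; rewrite (_ : A' = A)//; apply/funext => y; apply/funext. Qed.

Lemma l2_bounded_lim (A : nat -> X -> X -> R) A' B :
  (forall y x, A n y x @[n --> \oo] --> A' y x) ->
  (forall n, l2_bounded (A n) B) -> l2_bounded A' B.
Proof.
move=> cA hA c.
have csum (F : nat -> X -> R) (G : X -> R) : (forall x, F n x @[n --> \oo] --> G x) ->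
   (\sum_x F n x) @[n --> \oo] --> \sum_x G x.
  move=> h; elim: (index_enum X) => [|x s IH].
    by rewrite big_nil; under eq_fun do rewrite big_nil; exact: cvg_cst.
  by rewrite big_cons; under eq_fun do rewrite big_cons; exact: cvgD.
have h : (\sum_y w y * (\sum_x w x * c x * A n y x) ^+ 2) @[n --> \oo] -->
    \sum_y w y * (\sum_x w x * c x * A' y x) ^+ 2.
  apply: (csum) => y; apply: cvgMr; rewrite expr2.
  under eq_fun do rewrite expr2.
  by apply: cvgM; apply: (csum) => x; apply: cvgMr.
by apply: (ler_cvg_to h (cvg_cst _)); apply: nearW => n; exact: hA.
Qed.

Section taylor.
Variables (d : nat) (v t : X -> 'I_d -> R).
Hypothesis d0 : (0 < d)%N.
Hypothesis v1 : forall y i, `|v y i| <= 1.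
Hypothesis t1 : forall x i, `|t x i| <= 1.
Let u y x := \sum_i v y i * t x i.

(** A power of u = sum_i v_i(y) t_i(x) is a sum of products of functions of one
    variable, so multiplication by u / d does not increase the norm. *)
Lemma l2_bounded_pow A B k : 0 <= B -> l2_bounded A B ->
  l2_bounded (fun y x => A y x * (u y x / d%:R) ^+ k) B.
Proof.
move=> B0 hA; elim: k => [|k IH].
  by apply: l2_bounded_eq hA => y x; rewrite expr0 mulr1.
apply: (@l2_bounded_eq (fun y x => \sum_(i < d) d%:R^-1 *
   (v y i * (A y x * (u y x / d%:R) ^+ k) * t x i))).
  move=> y x; rewrite -mulr_sumr exprSr.
  rewrite (_ : \sum_i _ = A y x * (u y x / d%:R) ^+ k * u y x); first by ring.
  by rewrite {2}/u mulr_sumr; apply: eq_bigr => i _; ring.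
apply: (@l2_bounded_le _ ((\sum_(i < d) `|d%:R^-1 : R|) ^+ 2 * B)).
  rewrite sumr_const card_ord ger0_norm ?invr_ge0// -[_ *+ d]mulr_natr.
  by rewrite mulVf ?expr1n ?mul1r// pnatr_eq0 -lt0n.
apply: l2_bounded_comb => i; exact: l2_bounded_diag.
Qed.

(** The coefficients are dominated by those of the exponential series; every
    partial sum is controlled by [l2_bounded_pow] and the bound passes to the limit. *)
Lemma l2_bounded_series A B (a : nat -> R) (f : R -> R) : 0 <= B ->
  (forall k, `|a k| <= k`!%:R^-1) ->
  (forall z, series (fun k => a k * z ^+ k) n @[n --> \oo] --> f z) ->
  l2_bounded A B ->
  l2_bounded (fun y x => A y x * f (u y x)) (expR d%:R ^+ 2 * B).
Proof.
move=> B0 ha hf hA.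
apply: (@l2_bounded_lim (fun n y x => A y x * series (fun k => a k * u y x ^+ k) n)).
  by move=> y x; apply: cvgMr; exact: hf.
move=> n; apply: (@l2_bounded_eq (fun y x => \sum_(k < n) (a k * d%:R ^+ k) *
   (A y x * (u y x / d%:R) ^+ k))).
  move=> y x; rewrite /series/= big_mkord mulr_sumr; apply: eq_bigr => k _.
  rewrite expr_div_n; field.
  by rewrite expf_neq0// pnatr_eq0 -lt0n.
apply: (@l2_bounded_le _ ((\sum_(k < n) `|a k * d%:R ^+ k|) ^+ 2 * B)).
  apply: ler_wpM2r => //.
  rewrite ler_sqr ?nnegrE ?expR_ge0 ?sumr_ge0//.
  apply: (@le_trans _ _ (series (exp_coeff (d%:R : R)) n)).
    rewrite /series/= big_mkord; apply: ler_sum => k _.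
    rewrite normrM normrX normr_nat /exp_coeff/= mulrC.
    by apply: ler_wpM2l => //; rewrite exprn_ge0.
  apply: nondecreasing_cvgn_le; last exact: is_cvg_series_exp_coeff.
  apply: nondecreasing_series => k _ _.
  by rewrite /exp_coeff/= divr_ge0 ?exprn_ge0.
by apply: l2_bounded_comb => k; exact: l2_bounded_pow.
Qed.

(** A perturbation u(y,x) of the phase costs a constant factor only, although it
    need not be small: this allows y to be moved within a cube whose side is the
    inverse of the frequency. *)
Lemma l2_bounded_cosD (th : X -> X -> R) B : 0 <= B ->
  l2_bounded (fun y x => cos (th y x)) B -> l2_bounded (fun y x => sin (th y x)) B ->
  l2_bounded (fun y x => cos (th y x + u y x)) (4 * (expR d%:R ^+ 2 * B)) /\
  l2_bounded (fun y x => sin (th y x + u y x)) (4 * (expR d%:R ^+ 2 * B)).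
Proof.
move=> B0 hc hs.
have Hc A : l2_bounded A B -> l2_bounded (fun y x => A y x * cos (u y x)) (expR d%:R ^+ 2 * B).
  apply: (@l2_bounded_series _ _ (fun n => (~~ odd n)%:R * (-1) ^+ n./2 / n`!%:R)) => //.
    move=> k; rewrite !normrM normrX normrN1 expr1n mulr1 normfV !normr_nat.
    by case: (odd k); rewrite ?mul1r// mul0r invr_ge0.
  move=> z; rewrite unlock; have := @is_cvg_series_cos_coeff _ z.
  by rewrite cos_coeffE.
have Hs A : l2_bounded A B -> l2_bounded (fun y x => A y x * sin (u y x)) (expR d%:R ^+ 2 * B).
  apply: (@l2_bounded_series _ _ (fun n => (odd n)%:R * (-1) ^+ n.-1./2 / n`!%:R)) => //.
    move=> k; rewrite !normrM normrX normrN1 expr1n mulr1 normfV !normr_nat.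
    by case: (odd k); rewrite ?mul1r// mul0r invr_ge0.
  move=> z; rewrite unlock; have := @is_cvg_series_sin_coeff _ z.
  by rewrite sin_coeffE.
have two (A1 A2 : X -> X -> R) (s : R) B' : `|s| = 1 ->
    l2_bounded A1 B' -> l2_bounded A2 B' ->
    l2_bounded (fun y x => A1 y x + s * A2 y x) (4 * B').
  move=> s1 h1 h2.
  pose al (k : 'I_2) : R := if k == ord0 then 1 else s.
  pose AA (k : 'I_2) := if k == ord0 then A1 else A2.
  have h : l2_bounded (fun y x => \sum_k al k * AA k y x) (4 * B').
    rewrite (_ : 4 = (\sum_k `|al k|) ^+ 2).
      by apply: l2_bounded_comb => k; rewrite /AA; case: ifP.
    by rewrite !big_ord_recl big_ord0/= /al/= normr1 s1; ring.
  apply: l2_bounded_eq h => y x.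
  by rewrite !big_ord_recl big_ord0/= /al /AA/= mul1r addr0.
split.
  apply: l2_bounded_eq (two _ _ (-1) _ _ (Hc _ hc) (Hs _ hs)).
    by move=> y x; rewrite cosD mulN1r.
  by rewrite normrN1.
apply: l2_bounded_eq (two _ _ 1 _ _ (Hc _ hs) (Hs _ hc)).
  by move=> y x; rewrite sinD mul1r.
by rewrite normr1.
Qed.

End taylor.

(** A phase that depends on y alone does not change the modulus of the sum over x,
    and one that depends on x alone rotates the coefficients.  So the quadratic
    phase |x-y|^2 behaves as the bilinear phase -2 x.y. *)
Lemma chirp_bound (a b : X -> R) (z : X -> X -> R) B : 0 <= B ->
  l2_bounded (fun y x => cos (z y x)) B -> l2_bounded (fun y x => sin (z y x)) B ->
  forall c : X -> R,
  \sum_y w y * ((\sum_x w x * c x * cos (a x + b y - z y x)) ^+ 2 +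
                (\sum_x w x * c x * sin (a x + b y - z y x)) ^+ 2)
  <= 4 * B * \sum_x w x * c x ^+ 2.
Proof.
move=> B0 hc hs c.
pose C1 y := \sum_x w x * (c x * cos (a x)) * cos (z y x).
pose C2 y := \sum_x w x * (c x * sin (a x)) * sin (z y x).
pose S1 y := \sum_x w x * (c x * sin (a x)) * cos (z y x).
pose S2 y := \sum_x w x * (c x * cos (a x)) * sin (z y x).
apply: (@le_trans _ _ (\sum_y w y * (2 * (C1 y ^+ 2 + C2 y ^+ 2 + (S1 y ^+ 2 + S2 y ^+ 2))))).
  apply: ler_sum => y _; apply: ler_wpM2l => //.
  rewrite -sum_cosB.
  have rot x x' : a x + b y - z y x - (a x' + b y - z y x') = a x - z y x - (a x' - z y x').
    by ring.
  under eq_bigr => x _ do under eq_bigr => x' _ do rewrite rot.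
  rewrite (@sum_cosB R X (fun x => w x * c x) (fun x => a x - z y x)).
  rewrite (_ : \sum_x _ = C1 y + C2 y); last first.
    by rewrite -big_split/=; apply: eq_bigr => x _; rewrite cosB; ring.
  rewrite (_ : \sum_x _ * sin _ = S1 y - S2 y); last first.
    by rewrite -sumrB; apply: eq_bigr => x _; rewrite sinB; ring.
  have := sqr_ge0 (C1 y - C2 y); have := sqr_ge0 (S1 y + S2 y).
  lra.
have H1 := hc (fun x => c x * cos (a x)); have H2 := hs (fun x => c x * sin (a x)).
have H3 := hc (fun x => c x * sin (a x)); have H4 := hs (fun x => c x * cos (a x)).
have e : \sum_x w x * c x ^+ 2 = \sum_x w x * (c x * cos (a x)) ^+ 2 +
    \sum_x w x * (c x * sin (a x)) ^+ 2.
  rewrite -big_split/=; apply: eq_bigr => x _.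
  by rewrite -mulrDr !exprMn -mulrDr cos2Dsin2 mulr1.
have -> : \sum_y w y * (2 * (C1 y ^+ 2 + C2 y ^+ 2 + (S1 y ^+ 2 + S2 y ^+ 2))) =
  2 * (\sum_y w y * C1 y ^+ 2 + \sum_y w y * C2 y ^+ 2 +
      (\sum_y w y * S1 y ^+ 2 + \sum_y w y * S2 y ^+ 2)).
  by rewrite -!big_split/= mulr_sumr; apply: eq_bigr => y _; ring.
rewrite e; move: H1 H2 H3 H4; rewrite -/(C1 _) /C1 /C2 /S1 /S2; lra.
Qed.

End bnd.

(** * The collision bound *)

Section sums.
Variable R : realType.

Lemma ndist_le (a b : nat) : (a <= b)%N -> ndist a b = (b - a)%N.
Proof. by rewrite /ndist; lia. Qed.

Lemma ndist_ge (a b : nat) : (b <= a)%N -> ndist a b = (a - b)%N.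
Proof. by rewrite /ndist; lia. Qed.

(** Each value of the distance to k0 is attained at most twice. *)
Lemma sum_ndist_le (g : nat -> R) (M : nat) (k0 : 'I_M) : (forall n, 0 <= g n) ->
  \sum_(k < M) g (ndist k0 k) <= 2 * \sum_(k < M) g k.
Proof.
move=> g0; rewrite mulr2n mulrDl mul1r.
rewrite -(big_mkord predT (fun k => g (ndist k0 k))) -(big_mkord predT g).
have k0M := ltn_ord k0.
rewrite [leLHS](@big_cat_nat _ _ _ k0)/= ?(ltnW k0M)//.
apply: lerD.
  rewrite big_nat_rev/= add0n [leRHS](@big_cat_nat _ _ _ k0.+1)//=.
  rewrite big_nat_recl// -[leLHS]addr0 -[leLHS]add0r -addrA; apply: lerD => //.
  apply: lerD; last by apply: sumr_ge0.
  rewrite big_nat [leRHS]big_nat; apply: ler_sum => i ik.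
  by rewrite (_ : ndist _ _ = i.+1)// /ndist; lia.
rewrite (big_addn 0 M k0) [leRHS](@big_cat_nat _ _ _ (M - k0))//= ?leq_subr//.
rewrite -[leLHS]addr0; apply: lerD; last by apply: sumr_ge0.
apply: ler_sum => i _; by rewrite (_ : ndist _ _ = i)// /ndist; lia.
Qed.

(** Comparison with the telescoping series of 2/(k+1) - 2/(k+2). *)
Lemma sum_invsq_le M : \sum_(k < M) (k.+1%:R ^+ 2)^-1 <= 2 :> R.
Proof.
suff : \sum_(k < M) (k.+1%:R ^+ 2)^-1 <= 2 - 2 / M.+1%:R :> R.
  by move/le_trans; apply; rewrite gerBl divr_ge0.
elim: M => [|M IH]; first by rewrite big_ord0 divr1 subrr.
rewrite big_ord_recr/=; apply: (le_trans (lerD IH (lexx _))).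
have h : 0 < M.+1%:R :> R by rewrite ltr0n.
have h1 : 1 <= M.+1%:R :> R by rewrite ler1n.
rewrite -[M.+2%:R]natr1; set a : R := M.+1%:R in h h1 *.
rewrite -subr_ge0.
rewrite (_ : _ - _ = (a - 1) / (a ^+ 2 * (a + 1))); last first.
  by field; apply/andP; split; apply/eqP; lra.
by rewrite divr_ge0 ?mulr_ge0 ?sqr_ge0 ?subr_ge0//; lra.
Qed.

End sums.

Section energy.
Variables (R : realType) (X : finType) (d D l : nat) (w : X -> R)
  (p : X -> 'I_d -> R) (tau A : R).
Hypothesis w0 : forall x, 0 <= w x.
Hypothesis d0 : (0 < d)%N.
Hypothesis D0 : (0 < D)%N.
Hypothesis p0 : forall x i, 0 <= p x i.
Hypothesis pD : forall x i, p x i < D%:R.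
Hypothesis A0 : 0 <= A.
Hypothesis tau0 : 0 < tau.
Hypothesis tau1 : 2 ^+ d.+1 * tau ^+ 2 < 1.

(** The i-th coordinate of the index of the dyadic cube of side 2^-j that contains
    the point p x. *)
Definition cell (j : nat) (x : X) (i : 'I_d) : nat := Num.trunc (2 ^+ j * p x i).

Hypothesis wA : \sum_x w x <= A.
Hypothesis mass : forall j x0, (j <= l)%N ->
  \sum_(y | [forall i, cell j y i == cell j x0 i]) w y <= A * tau ^+ j.

Let sqd x y := \sum_i (p x i - p y i) ^+ 2.
(** The unit of frequency.  It is so small that 2 n eta x.(y - corner) is a scalar
    product of vectors with entries in [-1, 1] when the cube of y has side at most 1/n, and
    that all phase differences stay in the range where the Fejer kernel decays. *)
Let eta : R := (4 * d%:R * D%:R)^-1.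
Let dR : 1 <= d%:R :> R. Proof. by rewrite ler1n. Qed.
Let eta0 : 0 < eta.
Proof. by rewrite invr_gt0 !mulr_gt0// ltr0n. Qed.
Let etaE : eta * d%:R * D%:R = 4^-1.
Proof. by rewrite /eta; field; rewrite !pnatr_eq0 -!lt0n d0 D0. Qed.

(** The squared norm of the chirp transform of c at frequency z. *)
Let energy (z : R) (c : X -> R) := \sum_y w y *
  ((\sum_x w x * c x * cos (z * eta * sqd x y)) ^+ 2 +
   (\sum_x w x * c x * sin (z * eta * sqd x y)) ^+ 2).

Let energyN z c : energy (- z) c = energy z c.
Proof.
apply: eq_bigr => y _; congr (_ * (_ + _)).
  by congr (_ ^+ 2); apply: eq_bigr => x _; rewrite !mulNr cosN.
rewrite -[RHS]sqrrN -sumrN; congr (_ ^+ 2); apply: eq_bigr => x _.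
by rewrite !mulNr sinN mulrN.
Qed.

Let energy_ge0 z c : 0 <= energy z c.
Proof. by apply: sumr_ge0 => y _; rewrite mulr_ge0// addr_ge0// sqr_ge0. Qed.

Let energy0 c : energy 0 c <= A ^+ 2 * \sum_x w x * c x ^+ 2.
Proof.
rewrite /energy (eq_bigr (fun y => w y * (\sum_x w x * c x) ^+ 2)) => [|y _]; last first.
  congr (_ * _); rewrite [X in _ + X ^+ 2]big1 => [|x _]; last first.
    by rewrite !mul0r sin0 mulr0.
  by rewrite expr0n addr0; congr (_ ^+ 2); apply: eq_bigr => x _; rewrite !mul0r cos0 mulr1.
rewrite -mulr_suml.
have cs : (\sum_x w x * c x) ^+ 2 <= (\sum_x w x) * \sum_x w x * c x ^+ 2.
  have hs (x : X) : \sum_y w y * 1 <= \sum_x w x by apply: ler_sum => y _; rewrite mulr1.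
  have h := @schur_test R X w c (fun _ _ => 1) _ w0 (fun _ _ => ler01) (fun _ _ => erefl) hs.
  apply: le_trans h; rewrite expr2 big_distrlr/=.
  by apply: ler_sum => x _; apply: ler_sum => y _; rewrite mulr1.
have W0 : 0 <= \sum_x w x by apply: sumr_ge0.
apply: (le_trans (ler_wpM2l W0 cs)); rewrite mulrA -expr2.
by apply: ler_wpM2r; [exact: sum_wsqr_ge0|rewrite ler_sqr].
Qed.

(** This constant makes the decay of the Fejer kernel comparable with the
    inverse square of the distance between cells; see the definition of kap below. *)
Let K : R := (24 * d%:R) ^+ 2.
Let K0 : 0 < K. Proof. by rewrite exprn_gt0// mulr_gt0// ltr0n. Qed.
Let G : R := A ^+ 2 * (16 * K * D%:R) ^+ d.
Let G0 : 0 <= G.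
Proof. by rewrite mulr_ge0 ?sqr_ge0// exprn_ge0// !mulr_ge0// ltW. Qed.
Let r0 : R := 2 ^+ d * tau ^+ 2.
Let r00 : 0 < r0. Proof. by rewrite mulr_gt0 ?exprn_gt0. Qed.
Let C1 : R := 16 * expR d%:R ^+ 2 * G.
Let C10 : 0 <= C1.
Proof. by apply: mulr_ge0 G0; apply: mulr_ge0 => //; exact: sqr_ge0. Qed.

(** The large sieve at frequency n, where 2^j is the power of 2 between n and 2n.
    Up to constants, r0^j = 2^(jd) tau^(2j) is the number of cubes times the square of
    their mass. *)
Let energy_le (n j : nat) c : (j <= l)%N -> (n <= 2 ^ j <= 2 * n)%N ->
  energy n%:R c <= C1 * r0 ^+ j * \sum_x w x * c x ^+ 2.
Proof.
move=> jl /andP[nj jn].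
pose M := (D * 2 ^ j)%N.
have t0 : 0 < 2 ^+ j :> R by rewrite exprn_gt0.
have ME : M%:R = D%:R * 2 ^+ j :> R by rewrite natrM natrX.
have hM x i : (cell j x i < M)%N.
  rewrite /cell truncn_lt_nat ?mulr_ge0 ?(ltW t0)// ME mulrC.
  by rewrite ltr_pM2r.
pose m (x : X) : {ffun 'I_d -> 'I_M} := [ffun i => Ordinal (hM x i)].
(* with y = 2^-j m_y, the phase 2 n eta x.y becomes rho x.m_y *)
pose rho : R := 2 * eta * n%:R / 2 ^+ j.
have njR : n%:R <= 2 ^+ j :> R by rewrite -natrX ler_nat.
have jnR : 2 ^+ j <= 2 * n%:R :> R by rewrite -natrX -natrM ler_nat.
have rho1 : rho <= 2 * eta.
  by rewrite /rho ler_pdivrMr// ler_wpM2l// mulr_ge0// ltW.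
have rho2 : eta <= rho.
  rewrite /rho ler_pdivlMr//; have := eta0; nra.
have rho0 : 0 <= rho by apply: le_trans rho2; exact: ltW.
have rhoD : rho * D%:R <= 2^-1.
  have : eta * D%:R <= 4^-1.
    rewrite -etaE mulrAC ler_peMr// mulr_ge0// ltW//.
  have : (0 : R) <= D%:R by [].
  nra.
pose xi x i := rho * p x i.
have xi1 x i : `|xi x i| <= 1.
  rewrite ger0_norm; last exact: mulr_ge0.
  by apply: (le_trans (ler_wpM2l rho0 (ltW (pD x i)))); lra.
(* the position of y in its cube, in units of the side length *)
pose v y i : R := 2 ^+ j * p y i - (cell j y i)%:R.
have v1 y i : 0 <= v y i < 1.
  have := truncn_itv (mulr_ge0 (ltW t0) (p0 y i)).
  rewrite /v /cell -natr1 => /andP[]; lra.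
have v1' y i : `|v y i| <= 1.
  by have /andP[h1 h2] := v1 y i; rewrite ger0_norm// ltW.
(* on adjacent cells only the trivial bound is available, hence the shift k.+1 *)
pose kap (k : nat) : R := 4 * M%:R ^+ 2 * K / k.+1%:R ^+ 2.
have M0 : 0 < M%:R :> R by rewrite ME mulr_gt0// ltr0n.
have kap0 k : 0 <= kap k.
  by rewrite /kap divr_ge0 ?sqr_ge0// !mulr_ge0 ?sqr_ge0// ltW.
have hkap x y i : fejer R (M + M) (xi x i - xi y i) <= kap (ndist (m x i) (m y i)).
  rewrite !ffunE/=.
  set k := ndist _ _.
  have hk : k%:R - 1 <= 2 ^+ j * `|p x i - p y i|.
    have e : `|2 ^+ j * (p x i - p y i)| = 2 ^+ j * `|p x i - p y i|.
      by rewrite normrM (gtr0_norm t0).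
    rewrite -e.
    have -> : 2 ^+ j * (p x i - p y i) = (cell j x i)%:R - (cell j y i)%:R + (v x i - v y i).
      by rewrite /v; ring.
    have /andP[? ?] := v1 x i; have /andP[? ?] := v1 y i.
    have [cc|cc] := leqP (cell j x i) (cell j y i).
      have -> : k%:R = (cell j y i)%:R - (cell j x i)%:R :> R.
        by rewrite -natrB// /k ndist_le.
      rewrite -normrN; apply: le_trans (ler_norm _); lra.
    have -> : k%:R = (cell j x i)%:R - (cell j y i)%:R :> R.
      by rewrite /k ndist_ge ?natrB// ltnW.
    by apply: le_trans (ler_norm _); lra.
  have [k2|k2] := leqP k 1.
    apply: (le_trans (fejer_le _ _ _)).
    rewrite /kap addnn -mul2n (natrM _ 2).
    have k2R : k.+1%:R <= 2 :> R by rewrite ler_nat.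
    have k0R : 0 < k.+1%:R :> R by rewrite ltr0n.
    rewrite ler_pdivlMr ?exprn_gt0//.
    have hK : 4 <= K.
      have : 2 <= 24 * d%:R :> R by have := dR; lra.
      by rewrite /K; set z := 24 * _; nra.
    rewrite exprMn (_ : 2 ^+ 2 = 4 :> R); last by ring.
    apply: ler_wpM2l; first by rewrite mulr_ge0 ?sqr_ge0.
    nra.
  pose th := xi x i - xi y i.
  have thE : th = rho * (p x i - p y i) by rewrite /th /xi; ring.
  have th1 : `|th| <= 1.
    have := p0 x i; have := p0 y i; have := pD x i; have := pD y i.
    move=> *; rewrite thE normrM (ger0_norm rho0).
    have : `|p x i - p y i| <= D%:R by rewrite ler_norml; apply/andP; split; lra.
    nra.
  have kR : 2 <= k%:R :> R by rewrite ler_nat.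
  have th2 : eta * (k%:R - 1) <= 2 ^+ j * `|th|.
    rewrite thE normrM (ger0_norm rho0) mulrCA.
    apply: ler_pM => //; [exact: ltW|lra].
  have th3 : eta * (k.+1%:R) <= 3 * 2 ^+ j * `|th|.
    by rewrite -natr1; have := eta0; nra.
  have thp : 0 < `|th|.
    have : 0 < eta * (k%:R - 1) by rewrite mulr_gt0//; lra.
    nra.
  have fu := fejer_upper R (M + M) th th1.
  rewrite -(ler_pM2l (exprn_gt0 2 thp)) real_normK ?num_real//.
  apply: (le_trans fu).
  have k0R : 0 < k.+1%:R :> R by rewrite ltr0n.
  rewrite /kap mulrA ler_pdivlMr ?exprn_gt0//.
  have : 16 * (eta * k.+1%:R) ^+ 2 <= 16 * (3 * 2 ^+ j * `|th|) ^+ 2.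
    rewrite ler_pM2l// ler_sqr// nnegrE.
      by rewrite mulr_ge0// ltW.
    by rewrite mulr_ge0// ltW// mulr_gt0.
  rewrite !exprMn real_normK ?num_real// => h.
  have e2 : 0 < eta ^+ 2 by rewrite exprn_gt0.
  rewrite -(ler_pM2l e2).
  rewrite (_ : eta ^+ 2 * (16 * _) = 16 * (eta ^+ 2 * k.+1%:R ^+ 2)); last by ring.
  apply: (le_trans h).
  rewrite ME /K.
  have -> : eta ^+ 2 * (th ^+ 2 * (4 * (D%:R * 2 ^+ j) ^+ 2 * (24 * d%:R) ^+ 2)) =
     (48 * (eta * d%:R * D%:R)) ^+ 2 * (2 ^+ j) ^+ 2 * th ^+ 2 by ring.
  by rewrite etaE le_eqVlt; apply/orP; left; apply/eqP; field.
have hS (k0 : 'I_M) : \sum_(k < M) kap (ndist k0 k) <= 16 * K * M%:R ^+ 2.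
  apply: (le_trans (@sum_ndist_le R kap M k0 kap0)).
  rewrite /kap -mulr_sumr.
  have h := sum_invsq_le R M.
  have a0 : 0 <= 4 * M%:R ^+ 2 * K by rewrite !mulr_ge0 ?sqr_ge0// ltW.
  nra.
have hmu v' : \sum_(y | m y == v') w y <= A * tau ^+ j.
  have [x0 /eqP <-|no] := pickP (fun y => m y == v'); last first.
    by rewrite big_pred0// mulr_ge0// exprn_ge0// ltW.
  rewrite (eq_bigl (fun y => [forall i, cell j y i == cell j x0 i])); first exact: mass.
  move=> y; apply/eqP/forallP => [e i|h].
    by have /(congr1 val) := congr1 (fun f : {ffun 'I_d -> 'I_M} => f i) e; rewrite !ffunE /= => ->.
  by apply/ffunP => i; apply: val_inj; rewrite !ffunE/=; exact/eqP/h.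
have grid := @grid_bound R X d M w m xi kap _ _ w0 kap0 hmu hkap hS.
have {}grid c' : (\sum_y w y *
    ((\sum_x w x * c' x * cos (\sum_i xi x i * (m y i)%:R)) ^+ 2 +
     (\sum_x w x * c' x * sin (\sum_i xi x i * (m y i)%:R)) ^+ 2))
  <= G * r0 ^+ j * \sum_x w x * c' x ^+ 2.
  have Md : 0 < M%:R ^+ d :> R by rewrite exprn_gt0.
  rewrite -(ler_pM2l Md); apply: (le_trans (grid c')).
  rewrite [leRHS]mulrA; apply: ler_wpM2r; first exact: sum_wsqr_ge0.
  rewrite le_eqVlt; apply/orP; left; apply/eqP.
  have e1 : r0 ^+ j = (2 ^+ j) ^+ d * (tau ^+ j) ^+ 2.
    by rewrite /r0 exprMn -!exprM mulnC (mulnC 2%N).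
  have e2 : 16 * K * M%:R ^+ 2 = 16 * K * D%:R * 2 ^+ j * M%:R by rewrite ME; ring.
  rewrite /G e1 e2 2!(exprMn d); ring.
have B0 : 0 <= G * r0 ^+ j by rewrite mulr_ge0// exprn_ge0// ltW.
have hc : l2_bounded R X w (fun y x => cos (\sum_i xi x i * (m y i)%:R)) (G * r0 ^+ j).
  move=> c'; apply: le_trans (grid c'); apply: ler_sum => y _.
  by apply: ler_wpM2l => //; rewrite lerDl sqr_ge0.
have hs : l2_bounded R X w (fun y x => sin (\sum_i xi x i * (m y i)%:R)) (G * r0 ^+ j).
  move=> c'; apply: le_trans (grid c'); apply: ler_sum => y _.
  by apply: ler_wpM2l => //; rewrite lerDr sqr_ge0.
have [hc' hs'] := @l2_bounded_cosD R X w w0 d v xi d0 v1' xi1 _ _ B0 hc hs.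
have B1 : 0 <= 4 * (expR d%:R ^+ 2 * (G * r0 ^+ j)).
  by apply: mulr_ge0 => //; apply: mulr_ge0 => //; exact: sqr_ge0.
have := @chirp_bound R X w w0 (fun x => n%:R * eta * \sum_i p x i ^+ 2)
   (fun y => n%:R * eta * \sum_i p y i ^+ 2) _ _ B1 hc' hs' c.
have ph y x : n%:R * eta * (\sum_i p x i ^+ 2) + n%:R * eta * (\sum_i p y i ^+ 2) -
    (\sum_i xi x i * (m y i)%:R + \sum_i v y i * xi x i) = n%:R * eta * sqd x y.
  rewrite !mulr_sumr -!big_split/= -sumrB; apply: eq_bigr => i _.
  rewrite ffunE/= /v /xi.
  have -> : rho = 2 * eta * n%:R / 2 ^+ j by [].
  field; by rewrite expf_neq0.
rewrite [leRHS](_ : _ = C1 * r0 ^+ j * \sum_x w x * c x ^+ 2); last by rewrite /C1; ring.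
apply: le_trans.
rewrite le_eqVlt; apply/orP; left; apply/eqP; apply: eq_bigr => y _.
by congr (_ * (_ ^+ 2 + _ ^+ 2)); apply: eq_bigr => x _; rewrite ph.
Qed.

Let r : R := 2 ^+ d.+1 * tau ^+ 2.
Let rE : r = 2 * r0. Proof. by rewrite /r /r0 exprS mulrA. Qed.
(** A^2 comes from the frequency 0 and the other term from the geometric series
    over dyadic blocks of frequencies; the number of points and the scale l do not
    occur. *)
Definition collision_const : R := A ^+ 2 + C1 / (1 - r).
Let C2 : R := collision_const.

Lemma collision_const_ge0 : 0 <= collision_const.
Proof. by rewrite addr_ge0 ?sqr_ge0// divr_ge0// subr_ge0 ltW. Qed.

(** Each dyadic block of 2^j frequencies contributes at most a constant times r^j,
    and r = 2^(d+1) tau^2 < 1. *)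
Let sum_energy c (l' : nat) : (l' <= l)%N ->
  \sum_(n < 2 ^ l') energy n%:R c <= C2 * \sum_x w x * c x ^+ 2.
Proof.
set F := \sum_x w x * c x ^+ 2.
have F0 : 0 <= F by exact: sum_wsqr_ge0.
move=> ll.
have r_0 : 0 < r by rewrite rE mulr_gt0.
suff h : \sum_(n < 2 ^ l') energy n%:R c <= (A ^+ 2 + C1 * ((1 - r ^+ l') / (1 - r))) * F.
  apply: (le_trans h); apply: ler_wpM2r => //; rewrite /C2 /collision_const lerD2l.
  apply: ler_wpM2l => //; apply: ler_piMl; first by rewrite invr_ge0 subr_ge0 ltW.
  by rewrite gerBl exprn_ge0// ltW.
elim: l' ll => [|l' IH] ll.
  rewrite expn0 big_ord_recl big_ord0 addr0 expr0 subrr mul0r mulr0 addr0.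
  exact: energy0.
rewrite -(big_mkord predT (fun n => energy n%:R c)) (@big_cat_nat _ _ _ (2 ^ l'))//=; last first.
  by rewrite leq_exp2l.
rewrite big_mkord.
have {}IH := IH (ltnW ll).
apply: (le_trans (lerD IH (lexx _))).
have h2 : \sum_(2 ^ l' <= n < 2 ^ l'.+1) energy n%:R c <= C1 * r ^+ l' * F.
  apply: (@le_trans _ _ (\sum_(2 ^ l' <= n < 2 ^ l'.+1) C1 * r0 ^+ l'.+1 * F)).
    rewrite big_nat [leRHS]big_nat; apply: ler_sum => n /andP[n1 n2].
    apply: (@energy_le n l'.+1 c ll); by rewrite (ltnW n2) expnS leq_mul2l n1.
  rewrite sumr_const_nat expnS mul2n -addnn addnK -mulr_natl natrX.
  have -> : 2 ^+ l' * (C1 * r0 ^+ l'.+1 * F) = C1 * r ^+ l' * F * r0.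
    rewrite rE [(2 * r0) ^+ l']exprMn (exprS r0 l').
    by move: (2 ^+ l') (r0 ^+ l') => u v; ring.
  apply: ler_piMr.
    by apply: mulr_ge0 => //; apply: mulr_ge0 => //; apply: exprn_ge0; exact: ltW.
  by have := tau1; rewrite -/r rE; have := r00; lra.
apply: (le_trans (lerD (lexx _) h2)).
have geo (z a b q : R) : 1 - z != 0 ->
    (a + b * ((1 - q) / (1 - z))) * F + b * q * F = (a + b * ((1 - z * q) / (1 - z))) * F.
  by move=> ?; field.
rewrite (exprS r l') geo// gt_eqF// subr_gt0; exact: tau1.
Qed.

(** Two points x, x' at nearly the same distance from y have
    2^l eta ||x-y|^2 - |x'-y|^2| <= 1, so the indicator of this event is dominated
    by the normalised Fejer kernel; expanding the kernel turns the count of such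
    triples into the average of the energies over 2^l frequencies. *)
Lemma collision_bound (f : X -> R) (q : X -> X -> nat) :
  (forall x, 0 <= f x) ->
  (forall x x' y, q x y = q x' y -> 2 ^+ l * (eta * `|sqd x y - sqd x' y|) <= 1) ->
  \sum_y w y * (\sum_x \sum_x' (w x * f x) * (w x' * f x') * (q x y == q x' y)%:R)
  <= 8 * C2 / 2 ^+ l * \sum_x w x * f x ^+ 2.
Proof.
move=> f0 hq; set N := (2 ^ l)%N.
have NE : N%:R = 2 ^+ l :> R by rewrite natrX.
have N0 : 0 < N%:R :> R by rewrite NE exprn_gt0.
have h x x' y : (q x y == q x' y)%:R <= 4 / N%:R ^+ 2 * fejer R N (eta * (sqd x y - sqd x' y)).
  have N2 : 0 < N%:R ^+ 2 :> R by rewrite exprn_gt0.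
  rewrite mulrAC ler_pdivlMr//.
  case: eqP => [/hq e|_]; last by rewrite mul0r mulr_ge0// fejer_ge0.
  rewrite mul1r; have := @fejer_lower R N (eta * (sqd x y - sqd x' y)).
  rewrite normrM (gtr0_norm eta0) NE => /(_ e); lra.
apply: (@le_trans _ _ (\sum_y w y * (\sum_x \sum_x' (w x * f x) * (w x' * f x') *
   (4 / N%:R ^+ 2 * fejer R N (eta * (sqd x y - sqd x' y)))))).
  apply: ler_sum => y _; apply: ler_wpM2l => //.
  apply: ler_sum => x _; apply: ler_sum => x' _; apply: ler_wpM2l => //.
  by rewrite !mulr_ge0.
have -> : (\sum_y w y * (\sum_x \sum_x' (w x * f x) * (w x' * f x') *
   (4 / N%:R ^+ 2 * fejer R N (eta * (sqd x y - sqd x' y))))) =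
   4 / N%:R ^+ 2 * \sum_(a < N) \sum_(b < N) energy (a%:R - b%:R) f.
  rewrite /energy [in RHS]mulr_sumr.
  under [RHS]eq_bigr do rewrite exchange_big/= mulr_sumr.
  rewrite [RHS]exchange_big/=; apply: eq_bigr => y _.
  under [RHS]eq_bigr do rewrite mulr_sumr.
  under [RHS]eq_bigr do under eq_bigr do rewrite -sum_cosB mulrCA.
  under [RHS]eq_bigr do rewrite -mulr_sumr.
  rewrite -[RHS]mulr_sumr; congr (_ * _).
  rewrite [RHS](_ : _ = \sum_(a < N) \sum_(b < N) \sum_x \sum_x'
     4 / N%:R ^+ 2 * (w x * f x * (w x' * f x') *
     cos (eta * (sqd x y - sqd x' y) * (a%:R - b%:R)))).
    under [RHS]eq_bigr do rewrite exchange_big/=.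
    rewrite [RHS]exchange_big/=; apply: eq_bigr => x _.
    under [RHS]eq_bigr do rewrite exchange_big/=.
    rewrite [RHS]exchange_big/=; apply: eq_bigr => x' _.
    rewrite /fejer !mulr_sumr; apply: eq_bigr => a _.
    rewrite !mulr_sumr; apply: eq_bigr => b _; ring.
  apply: eq_bigr => a _; apply: eq_bigr => b _.
  rewrite mulr_sumr; apply: eq_bigr => x _; rewrite mulr_sumr; apply: eq_bigr => x' _.
  by congr (_ * (_ * cos _)); ring.
have hab (a b : 'I_N) : energy (a%:R - b%:R) f = energy (ndist a b)%:R f.
  have [ab|ab] := leqP a b.
    by rewrite -energyN opprB -natrB// ndist_le.
  by rewrite ndist_ge ?natrB// ltnW.
have step : \sum_(a < N) \sum_(b < N) energy (a%:R - b%:R) f <=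
    N%:R * (2 * (C2 * \sum_x w x * f x ^+ 2)).
  apply: (@le_trans _ _ (\sum_(a < N) (2 * (C2 * \sum_x w x * f x ^+ 2)))).
    apply: ler_sum => a _; under eq_bigr do rewrite hab.
    apply: (le_trans (@sum_ndist_le R (fun n => energy n%:R f) N a _)) => //.
    by rewrite ler_pM2l// sum_energy.
  by rewrite sumr_const card_ord -[leLHS]mulr_natl lexx.
apply: (@le_trans _ _ (4 / N%:R ^+ 2 * (N%:R * (2 * (C2 * \sum_x w x * f x ^+ 2))))).
  by apply: ler_wpM2l => //; rewrite divr_ge0// sqr_ge0.
rewrite -NE le_eqVlt; apply/orP; left; apply/eqP; field.
by rewrite gt_eqF.
Qed.

End energy.

(** * Counting distance vectors of chains *)

Section chains.
Variables (R : realType) (X : finType) (w : X -> R) (q : X -> X -> nat) (Q : nat)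
  (kappa : R).
Hypothesis w0 : forall x, 0 <= w x.
Hypothesis qQ : forall x y, (q x y < Q)%N.
Hypothesis kappa0 : 0 <= kappa.
Hypothesis collision : forall f : X -> R, (forall x, 0 <= f x) ->
  \sum_y w y * (\sum_x \sum_x' (w x * f x) * (w x' * f x') * (q x y == q x' y)%:R)
  <= kappa * \sum_x w x * f x ^+ 2.

(** The mass of the chains that start at y and follow the prescribed rounded
    distances t; it is T_(j_1) ... T_(j_k) 1 evaluated at y. *)
Fixpoint chain_mass (t : seq nat) (y : X) : R :=
  if t is j :: t' then \sum_x w x * chain_mass t' x * (q x y == j)%:R else 1.

Fixpoint vectors (k : nat) : seq (seq nat) :=
  if k is k'.+1 then [seq j :: t | j <- iota 0 Q, t <- vectors k'] else [:: [::]].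

Lemma vectors_uniq k : uniq (vectors k).
Proof.
elim: k => //= k IH; apply: allpairs_uniq => //; first exact: iota_uniq.
by move=> [a b] [a' b'] _ _ /= [-> ->].
Qed.

Lemma size_vectors k t : t \in vectors k -> size t = k.
Proof.
elim: k t => [|k IH] t /=; first by rewrite inE => /eqP ->.
by move=> /allpairsP[[j s] [_ /IH hs ->]] /=; rewrite hs.
Qed.

Lemma chain_mass_ge0 t y : 0 <= chain_mass t y.
Proof.
elim: t y => //= j t IH y; apply: sumr_ge0 => x _.
by rewrite mulr_ge0// mulr_ge0.
Qed.

Lemma sum_iota_eq (n : nat) (F : nat -> R) : (n < Q)%N ->
  \sum_(j <- iota 0 Q) F j * (n == j)%:R = F n.
Proof.
move=> nQ; rewrite (bigD1_seq n) ?iota_uniq ?mem_iota//= eqxx mulr1.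
by rewrite big1 ?addr0// => j /negbTE; rewrite eq_sym => ->; rewrite mulr0.
Qed.

Let W := \sum_x w x.

Lemma sum_chain_mass k y : \sum_(t <- vectors k) chain_mass t y = W ^+ k.
Proof.
elim: k y => [|k IH] y /=; first by rewrite big_seq1.
rewrite big_allpairs_dep/= exchange_big/=.
transitivity (\sum_(t <- vectors k) \sum_x w x * chain_mass t x).
  apply: eq_bigr => t _; rewrite exchange_big/=; apply: eq_bigr => x _.
  by rewrite (sum_iota_eq _ (fun=> w x * chain_mass t x)).
rewrite exchange_big/= exprSr [RHS]mulrC /W mulr_suml; apply: eq_bigr => x _.
by rewrite -mulr_sumr IH.
Qed.

(** One more link costs one factor kappa: for each fixed t, the collision hypothesis
    is applied to the function [chain_mass t]. *)
Lemma chain_energy k :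
  \sum_(t <- vectors k) \sum_y w y * chain_mass t y ^+ 2 <= kappa ^+ k * W.
Proof.
elim: k => [|k IH] /=.
  by rewrite big_seq1 mul1r; apply: ler_sum => y _; rewrite expr1n mulr1.
rewrite big_allpairs_dep/= exchange_big/= exprS -mulrA.
apply: le_trans (ler_wpM2l kappa0 IH).
rewrite mulr_sumr; apply: ler_sum => t _.
apply: le_trans (collision (chain_mass t) (chain_mass_ge0 t)).
rewrite exchange_big/=; apply: ler_sum => y _.
rewrite -mulr_sumr; apply: ler_wpM2l => //.
rewrite [leLHS](eq_bigr (fun j => \sum_x \sum_x'
  (w x * chain_mass t x * (q x y == j)%:R) * (w x' * chain_mass t x' * (q x' y == j)%:R))).
  2: by move=> j _; rewrite expr2 big_distrlr.
rewrite exchange_big/=; apply: ler_sum => x _.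
rewrite exchange_big/=; apply: ler_sum => x' _.
rewrite -(@sum_iota_eq (q x y) (fun j => (w x * chain_mass t x) *
  (w x' * chain_mass t x') * (j == q x' y)%:R))//.
apply: ler_sum => j _; rewrite [in leRHS]eq_sym.
by rewrite le_eqVlt; apply/orP; left; apply/eqP; ring.
Qed.

(** The distance vectors that carry positive mass; by [realisedP] they come from
    chains of points. *)
Definition realised k := [seq t <- vectors k | 0 < \sum_y w y * chain_mass t y].

(** The total mass W^(k+1) of all chains is spread over the realised vectors only,
    while its square sum is at most kappa^k W; the Cauchy-Schwarz inequality bounds
    the number of these vectors from below. *)
Lemma many_realised k : 0 < W ->
  W ^+ k.*2 <= (size (realised k))%:R * kappa ^+ k.
Proof.
move=> W0; set S := realised k; set s : R := (size S)%:R.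
pose E := \sum_(t <- S) \sum_y w y * chain_mass t y ^+ 2.
have hE : E <= kappa ^+ k * W.
  apply: le_trans (chain_energy k); rewrite /E /S /realised big_filter.
  rewrite [leRHS](bigID (fun t => 0 < \sum_y w y * chain_mass t y))/= lerDl.
  by apply: sumr_ge0 => t _; apply: sum_wsqr_ge0.
have hM : \sum_(t <- S) \sum_y w y * chain_mass t y = W ^+ k.+1.
  rewrite /S /realised big_filter.
  transitivity (\sum_(t <- vectors k) \sum_y w y * chain_mass t y).
    rewrite [RHS](bigID (fun t => 0 < \sum_y w y * chain_mass t y))/=.
    rewrite [X in _ + X]big1 ?addr0// => t; rewrite -leNgt => h.
    apply/eqP; rewrite eq_le h/=; apply: sumr_ge0 => y _.
    by rewrite mulr_ge0// chain_mass_ge0.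
  rewrite exchange_big/= exprS [in RHS]/W mulr_suml; apply: eq_bigr => y _.
  by rewrite -mulr_sumr sum_chain_mass.
(* expand sum w (V - z)^2 >= 0; s W is the total mass of the pairs (t, y) *)
have quad (z : R) : 0 <= E - 2 * z * W ^+ k.+1 + z ^+ 2 * (s * W).
  have : 0 <= \sum_(t <- S) \sum_y w y * (chain_mass t y - z) ^+ 2.
    by apply: sumr_ge0 => t _; apply: sumr_ge0 => y _; rewrite mulr_ge0// sqr_ge0.
  rewrite (_ : \sum_(t <- S) _ = E - 2 * z * W ^+ k.+1 + z ^+ 2 * (s * W))//.
  rewrite /E -hM [X in _ - X + _]mulr_sumr.
  have -> : z ^+ 2 * (s * W) = \sum_(t <- S) z ^+ 2 * W.
    by rewrite big_const_seq count_predT iter_addr_0 -mulr_natl /s; ring.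
  rewrite -sumrB -big_split/=; apply: eq_bigr => t _.
  rewrite /W !mulr_sumr -sumrB -big_split/=; apply: eq_bigr => y _; ring.
have Wk : 0 < W ^+ k by rewrite exprn_gt0.
have s0 : 0 < s.
  rewrite ltr0n lt0n; apply/negP => /eqP s0.
  move: hM; rewrite (size0nil s0) big_nil => /esym/eqP.
  by rewrite gt_eqF// exprn_gt0.
(* the value of z that minimises the quadratic polynomial *)
have := quad (W ^+ k / s).
rewrite exprS.
have -> : E - 2 * (W ^+ k / s) * (W * W ^+ k) + (W ^+ k / s) ^+ 2 * (s * W) =
   E - (W ^+ k) ^+ 2 * W / s by field; rewrite gt_eqF.
rewrite subr_ge0 ler_pdivrMr// => h.
rewrite -muln2 exprM -(ler_pM2r W0); apply: (le_trans h).
have -> : s * kappa ^+ k * W = kappa ^+ k * W * s by ring.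
exact: ler_wpM2r (ltW s0) _ _ hE.
Qed.

Lemma chain_mass_gt0 t y : 0 < chain_mass t y ->
  exists c : nat -> X, c 0%N = y /\
    forall i, (i < size t)%N -> q (c i.+1) (c i) = nth 0%N t i.
Proof.
elim: t y => [|j t IH] y /=; first by exists (fun=> y).
move=> h.
have [x hx|no] := pickP (fun x => (0 < chain_mass t x) && (q x y == j)).
  have /andP[/IH[c [c0 hc]] /eqP qj] := hx.
  exists (fun n => if n is n'.+1 then c n' else y); split => // -[|i] /=.
    by rewrite c0.
  by rewrite ltnS => /hc.
move: h; rewrite big1 ?ltxx// => x _; have := no x.
have := chain_mass_ge0 t x; rewrite le_eqVlt => /orP[/eqP <-|->/= ->].
  by rewrite mulr0 mul0r.
by rewrite mulr0.
Qed.

Lemma realisedP k t : t \in realised k ->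
  size t = k /\ exists c : nat -> X,
    forall i, (i < k)%N -> q (c i.+1) (c i) = nth 0%N t i.
Proof.
rewrite mem_filter => /andP[h /size_vectors hs]; split => //.
have [y hy|no] := pickP (fun y => 0 < chain_mass t y).
  by have [c [_ hc]] := chain_mass_gt0 _ _ hy; exists c => i; rewrite -hs; exact: hc.
move: h; rewrite big1 ?ltxx// => y _; have := no y.
by have := chain_mass_ge0 t y; rewrite le_eqVlt => /orP[/eqP <-|->//]; rewrite mulr0.
Qed.

End chains.

(** * From counting to Lebesgue measure *)

Section closed.
Variable R : realType.
Import ArrowAsProduct.

Lemma continuous_sum (T : topologicalType) (I : Type) (s : seq I) (f : I -> T -> R) :
  (forall i, continuous (f i)) -> continuous (fun x => \sum_(i <- s) f i x).
Proof.
move=> cf; elim: s => [|i s IH] x.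
  by under eq_fun do rewrite big_nil; exact: cvg_cst.
by under eq_fun do rewrite big_cons; apply: cvgD; [exact: cf|exact: IH].
Qed.

Lemma enorm_continuous d : continuous (@enorm R d).
Proof.
move=> x; apply: (@continuous_comp _ _ _ (fun x : 'rV[R]_d => \sum_i x ord0 i ^+ 2) Num.sqrt).
  apply: continuous_sum => i.
  rewrite (_ : (fun x => _) = (fun x : 'rV[R]_d => x ord0 i * x ord0 i)).
    by move=> y; have h := @coord_continuous R 1 d ord0 i y; exact: (cvgM h h).
  by apply/funext => y; rewrite expr2.
exact: sqrt_continuous.
Qed.

(** The total error sum_i |t_i - |x^i - x^(i+1)|| is continuous on the compact space
    of chains, so its infimum 0 is attained. *)
Lemma chain_distances_closed d k (E : set 'rV[R]_d) (t : 'I_k -> R) : compact E ->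
  (forall eps, 0 < eps -> exists x : 'I_k.+1 -> 'rV[R]_d, (forall i, E (x i)) /\
    forall i : 'I_k, `|t i - enorm (x (inord i) - x (inord i.+1))| <= eps) ->
  exists x : 'I_k.+1 -> 'rV[R]_d, (forall i, E (x i)) /\
    forall i : 'I_k, t i = enorm (x (inord i) - x (inord i.+1)).
Proof.
move=> cE happ.
pose T := forall i : 'I_k.+1, (fun=> 'rV[R]_d : topologicalType) i.
pose g (x : T) := \sum_(i < k) `|t i - enorm (x (inord i) - x (inord i.+1))|.
have cg : continuous g.
  have hp j : continuous (fun x : T => x j) by exact: (@proj_continuous _ (fun=> 'rV[R]_d)).
  apply: continuous_sum => i x.
  have Fx : Filter (nbhs x) by exact: nbhs_filter.
  have /(_ Fx) h1 := cvgB (hp (inord i) x) (hp (inord i.+1) x).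
  have h2 := cvg_comp _ _ h1 (@enorm_continuous d _).
  by have /(_ Fx) h4 := cvgB (@cvg_cst _ (t i) _ _ Fx) h2; exact: (cvg_norm h4).
have cT := @tychonoff 'I_k.+1 (fun=> 'rV[R]_d) (fun=> E) (fun=> cE).
have [x0 [Ex0 _]] := happ 1 ltr01.
have [c] := @compact_EVT_min _ R g _ (ex_intro _ x0 Ex0) cT (continuous_subspaceT cg).
rewrite inE /= => Ec cmin; exists c; split => // i.
have gc0 : g c <= 0.
  apply/ler_addgt0Pr => e e0; rewrite add0r.
  have [|x [Ex hx]] := happ (e / k.+1%:R); first by rewrite divr_gt0.
  apply: le_trans (cmin x _) _; first by rewrite inE.
  apply: (@le_trans _ _ (\sum_(i < k) e / k.+1%:R)); first by apply: ler_sum => j _; exact: hx.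
  rewrite sumr_const card_ord -[leLHS]mulr_natr mulrAC ler_pdivrMr// ler_pM2l//.
  by rewrite ler_nat.
apply/eqP; rewrite -subr_eq0 -normr_eq0 eq_le normr_ge0 andbT.
apply: le_trans gc0; rewrite /g (bigD1 i)//= lerDl; exact: sumr_ge0.
Qed.

End closed.

Section cells.
Variable R : realType.
Implicit Types (k l : nat).

(** Passing to a dyadic parent halves the index. *)
Lemma trunc_half (x : R) : 0 <= x -> Num.trunc x = (Num.trunc (2 * x))./2.
Proof.
move=> x0; apply/truncn_def.
have /andP[] := truncn_itv (mulr_ge0 (ler0n R 2) x0).
set n := Num.trunc _ => h1 h2.
have e : n%:R = (odd n)%:R + 2 * (n./2)%:R :> R.
  by rewrite -{1}(odd_double_half n) natrD -mul2n natrM.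
have : 0 <= ((odd n)%:R : R) <= 1 by rewrite ler0n lern1 leq_b1.
by move: h1 h2 => + + /andP[]; rewrite -!natr1 e => *; apply/andP; split; lra.
Qed.

Lemma trunc_eq_itv l (x : R) (n : nat) : 0 <= x ->
  (Num.trunc (2 ^+ l * x) = n) <-> (`[n%:R / 2 ^+ l, n.+1%:R / 2 ^+ l[%classic x).
Proof.
move=> x0; have t0 : 0 < 2 ^+ l :> R by rewrite exprn_gt0.
have h : (`[n%:R / 2 ^+ l, n.+1%:R / 2 ^+ l[%classic x) = (n%:R <= 2 ^+ l * x < n.+1%:R).
  by rewrite /= in_itv/= ler_pdivrMr// ltr_pdivlMr// mulrC.
rewrite h; split=> [<-|]; last exact: truncn_def.
by apply: truncn_itv; rewrite mulr_ge0// ltW.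
Qed.

Lemma trunc_eq_pred l (x y : R) : 0 <= x -> 0 <= y ->
  Num.trunc (2 ^+ l.+1 * x) = Num.trunc (2 ^+ l.+1 * y) ->
  Num.trunc (2 ^+ l * x) = Num.trunc (2 ^+ l * y).
Proof.
move=> x0 y0 h; have t0 : 0 <= 2 ^+ l :> R by rewrite exprn_ge0.
by rewrite trunc_half ?mulr_ge0// [RHS]trunc_half ?mulr_ge0// !mulrA -exprS h.
Qed.

Definition dyadic_cell k l (v : k.-tuple nat) : set (k.-tuple (measurableTypeR R)) :=
  [set t | forall i, `[(tnth v i)%:R / 2 ^+ l, (tnth v i).+1%:R / 2 ^+ l[%classic (tnth t i)].

Lemma measurable_box k (A : 'I_k -> set (measurableTypeR R)) :
  (forall i, measurable (A i)) ->
  measurable [set t : k.-tuple (measurableTypeR R) | forall i, A i (tnth t i)].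
Proof.
move=> mA; rewrite (_ : [set _ | _] = \bigcap_(i in [set: 'I_k])
    ((@tnth k (measurableTypeR R))^~ i @^-1` A i)).
  apply: fin_bigcap_measurable => [|i _]; first exact: finite_finset.
  by rewrite -[X in measurable X]setTI; exact: measurable_tnth.
by apply/seteqP; split => t /= h i; [move=> _|]; exact: h.
Qed.

Lemma lebesgue_dyadic_cell k l (v : k.-tuple nat) :
  lebesgue_tuple k (dyadic_cell k l v) = ((2 ^+ (l * k))^-1)%:E.
Proof.
have t0 : 0 < 2 ^+ l :> R by rewrite exprn_gt0.
pose A (i : 'I_k) : set (measurableTypeR R) :=
  `[(tnth v i)%:R / 2 ^+ l, (tnth v i).+1%:R / 2 ^+ l[%classic.
have mA i : measurable (A i) by exact: measurable_itv.
rewrite (lebesgue_tupleE mA).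
rewrite (eq_bigr (fun=> ((2 ^+ l)^-1)%:E)); last first.
  move=> i _; rewrite lebesgue_measure_itv/= lte_fin ltr_pM2r ?invr_gt0// ltr_nat ltnSn.
  by rewrite -EFinB -mulrBl -natr1 addrAC subrr add0r mul1r.
by rewrite prodEFin prodr_const card_ord exprM exprVn.
Qed.

(** The union G_l of the cells of side 2^-l that meet K decreases to K, because K
    contains every point that is approximated at all scales; and G_l contains at
    least c 2^(lk) disjoint cells, each of measure 2^-(lk). *)
Lemma lebesgue_tuple_ge k (K : set (k.-tuple (measurableTypeR R))) (c B : R) :
  0 < B ->
  (forall u, K u -> forall i, 0 <= tnth u i < B) ->
  (forall t, (forall i, 0 <= tnth t i) ->
    (forall l, exists2 u, K u & forall i,
      Num.trunc (2 ^+ l * tnth t i) = Num.trunc (2 ^+ l * tnth u i)) -> K t) ->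
  (forall l, exists S : seq (seq nat), [/\ uniq S,
    (forall v, v \in S -> size v = k /\
      exists2 u, K u & forall i : 'I_k, Num.trunc (2 ^+ l * tnth u i) = nth 0%N v i) &
    c * 2 ^+ (l * k) <= (size S)%:R]) ->
  (c%:E <= lebesgue_tuple k K)%E.
Proof.
move=> B0 KB Kcl Kc.
pose P l : set (k.-tuple nat) := [set v | exists2 u, K u &
  forall i, Num.trunc (2 ^+ l * tnth u i) = tnth v i].
pose G l : set (k.-tuple (measurableTypeR R)) := \bigcup_(v in P l) dyadic_cell k l v.
have t0 l : 0 < 2 ^+ l :> R by rewrite exprn_gt0.
have GP l t : G l t <-> (forall i, 0 <= tnth t i) /\ (exists2 u, K u & forall i,
      Num.trunc (2 ^+ l * tnth t i) = Num.trunc (2 ^+ l * tnth u i)).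
  split.
    move=> [v [u Ku uv] tv].
    have tp i : 0 <= tnth t i.
      have := tv i; rewrite /= in_itv/= => /andP[+ _]; apply: le_trans.
      by rewrite divr_ge0// ltW.
    split => //; exists u => // i; rewrite uv; apply/(trunc_eq_itv _ _ _ (tp i)); exact: tv.
  move=> [tp [u Ku tu]]; exists [tuple Num.trunc (2 ^+ l * tnth u i) | i < k].
    by exists u => // i; rewrite tnth_mktuple.
  by move=> i; rewrite tnth_mktuple; apply/(trunc_eq_itv _ _ _ (tp i)).
have mcell l v : measurable (dyadic_cell k l v).
  apply: (measurable_box k (fun i => `[(tnth v i)%:R / 2 ^+ l, (tnth v i).+1%:R / 2 ^+ l[%classic)).
  by move=> i; exact: measurable_itv.
have mG l : measurable (G l).
  rewrite /G bigcup_mkcond; apply: countable_bigcupT_measurable.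
    exact: countableP.
  by move=> v; case: ifP.
have GK : \bigcap_l G l = K.
  apply/seteqP; split => t.
    move=> h; apply: Kcl; first by have /GP[] := h 0%N Logic.I.
    by move=> l; have /GP[] := h l Logic.I.
  move=> Kt l _; apply/GP; split => [i|]; last by exists t.
  by have /andP[] := KB t Kt i.
have GS l : G l.+1 `<=` G l.
  move=> t /GP[tp [u Ku h]]; apply/GP; split => //; exists u => // i.
  by apply: trunc_eq_pred (h i) => //; have /andP[] := KB u Ku i.
have Gdec : {homo G : n m / (n <= m)%N >-> (m <= n)%O}.
  by apply/nonincreasing_seqP => n; apply/subsetPset; exact: GS.
have Gfin : (lebesgue_tuple k (G 0%N) < +oo)%E.
  pose bx : set (k.-tuple (measurableTypeR R)) :=
    [set t | forall i, `[0, B + 1]%classic (tnth t i)].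
  have mb : measurable bx.
    by apply: (measurable_box k (fun=> `[0, B + 1]%classic)) => i; exact: measurable_itv.
  apply: (@le_lt_trans _ _ (lebesgue_tuple k bx)).
    apply: le_measure; rewrite ?inE// => t /GP[tp [u Ku h]] i /=.
    rewrite in_itv/= tp/=.
    have /andP[u0 uB] := KB u Ku i; move: (h i); rewrite !expr0 !mul1r => e.
    have := truncn_itv (tp i); have := truncn_itv u0; rewrite e -natr1.
    by move=> /andP[? ?] /andP[? ?]; lra.
  pose A (i : 'I_k) : set (measurableTypeR R) := `[0, B + 1]%classic.
  have mA i : measurable (A i) by exact: measurable_itv.
  rewrite (lebesgue_tupleE mA) /A.
  rewrite lebesgue_measure_itv/= lte_fin addr_gt0// -EFinB prodEFin; exact: ltry.
have cvG := nonincreasing_cvg_mu Gfin mG (bigcap_measurableType (fun n _ => mG n)) Gdec.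
rewrite GK in cvG; rewrite -(cvg_lim _ cvG)//.
apply: lime_ge; first by apply/cvg_ex; eexists; exact: cvG.
apply: nearW => l /=.
have [S [uS hS cS]] := Kc l.
pose S' : seq (k.-tuple nat) := pmap insub S.
have S'E : map val S' = S.
  rewrite pmap_filter; last by move=> v; exact: insubK.
  by apply/all_filterP/allP => v /hS[sv _]; rewrite /= isSome_insub sv.
have uS' : uniq S' by rewrite -(map_inj_uniq val_inj) S'E.
have sub : \bigcup_(v in [set` S']) dyadic_cell k l v `<=` G l.
  move=> t [v vS tv]; exists v => //.
  have /hS[_ [u Ku hu]] : val v \in S by rewrite -S'E map_f.
  by exists u => // i; rewrite hu (tnth_nth 0%N).
have fS : finite_set [set` S'] by exact: finite_seq.
apply: (@le_trans _ _ (lebesgue_tuple k (\bigcup_(v in [set` S']) dyadic_cell k l v))); last first.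
  apply: le_measure; rewrite ?inE//; apply: fin_bigcup_measurable => //.
rewrite measure_fin_bigcup//; last first.
  move=> v v' _ _ [t [tv tv']]; apply: eq_from_tnth => i.
  have tp : 0 <= tnth t i.
    have := tv i; rewrite /= in_itv/= => /andP[+ _]; apply: le_trans.
    by rewrite divr_ge0// ltW.
  by have /(trunc_eq_itv _ _ _ tp) <- := tv i; have /(trunc_eq_itv _ _ _ tp) := tv' i.
rewrite -fsbig_seq//=.
under eq_bigr do rewrite lebesgue_dyadic_cell.
rewrite sumEFin lee_fin big_const_seq count_predT iter_addr_0.
rewrite -[leRHS]mulr_natl -(size_map val S') S'E.
by rewrite ler_pdivlMr.
Qed.

End cells.

(** * Frostman weights on finite trees and Hausdorff measure *)

Section saturate.
Variables (R : realType) (X I : finType) (i0 : I) (cl : I -> rel X) (cap : I -> R).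
Hypothesis cl_refl : forall i x, cl i x x.
Hypothesis cl_eq : forall i x y z, cl i x y -> cl i x z = cl i y z.
Hypothesis cap0 : forall i, 0 <= cap i.

(** A greedy construction: the points are visited one after the other, and each gets
    the largest weight that its cells still admit.  A visited point then lies in a
    saturated cell, and saturated cells stay saturated since weights only increase. *)
Lemma saturated_weights : exists w : X -> R, [/\ forall x, 0 <= w x,
  forall i x, \sum_(y | cl i x y) w y <= cap i &
  forall x, exists i, \sum_(y | cl i x y) w y = cap i].
Proof.
suff [w [w0 wcap wsat]] : exists w : X -> R, [/\ forall x, 0 <= w x,
  forall i x, \sum_(y | cl i x y) w y <= cap i &
  forall x, x \in enum X -> exists i, \sum_(y | cl i x y) w y = cap i].
  by exists w; split => // x; apply: wsat; rewrite mem_enum.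
elim: (enum X) => [|a s [w [w0 wcap wsat]]].
  by exists (fun=> 0); split => // i x; rewrite big1.
pose slack i := cap i - \sum_(y | cl i a y) w y.
have [m _ hm] := @Order.TotalTheory.arg_minP _ R I i0 predT slack isT.
have sl0 i : 0 <= slack i by rewrite subr_ge0.
(* the slack is attained at level m, whose cell becomes saturated *)
pose w' y := w y + slack m * (y == a)%:R.
have w'E i x : \sum_(y | cl i x y) w' y =
    \sum_(y | cl i x y) w y + slack m * (cl i x a)%:R.
  rewrite big_split/= -mulr_sumr; congr (_ + _ * _).
  have [h|h] := boolP (cl i x a).
    by rewrite (bigD1 a)//= eqxx big1 ?addr0// => y /andP[_ /negbTE ->].
  by rewrite big1// => y hy; case: eqP => // e; move: h; rewrite -e hy.
have same i x : cl i x a -> \sum_(y | cl i x y) w y = \sum_(y | cl i a y) w y.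
  by move=> h; apply: eq_bigl => y; exact: cl_eq.
have w'cap i x : \sum_(y | cl i x y) w' y <= cap i.
  rewrite w'E; have [h|h] := boolP (cl i x a); last by rewrite mulr0 addr0.
  by rewrite mulr1 same// -lerBrDl; exact: hm.
exists w'; split => //.
  by move=> x; rewrite /w' addr_ge0// mulr_ge0.
move=> x; rewrite inE => /orP[/eqP ->|xs].
  by exists m; rewrite w'E cl_refl mulr1 /slack addrC subrK.
have [i hi] := wsat x xs; exists i; apply/eqP; rewrite eq_le w'cap/= -hi.
by rewrite w'E lerDl mulr_ge0.
Qed.

End saturate.

Section frostman_tree.
Variables (R : realType) (X : finType) (n : nat) (cl : 'I_n.+1 -> rel X)
  (cap : 'I_n.+1 -> R).
Hypothesis cl_refl : forall i x, cl i x x.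
Hypothesis cl_eq : forall i x y z, cl i x y -> cl i x z = cl i y z.
Hypothesis cl_nested : forall (i j : 'I_n.+1) x y, (i <= j)%N -> cl j x y -> cl i x y.
Hypothesis cap0 : forall i, 0 <= cap i.

(** Frostman's lemma on a finite tree.  The largest saturated cells that contain the
    points of X form a partition of X, as cells are nested.  So the total mass is
    the sum of the capacities of a cover by cells. *)
Lemma tree_frostman : exists w : X -> R, exists P : {set {set X}},
  [/\ forall x, 0 <= w x,
   forall i x, \sum_(y | cl i x y) w y <= cap i,
   finset.cover P = [set: X]%SET,
   forall C, C \in P -> exists i, exists x,
     C = [set y | cl i x y]%SET /\ \sum_(y in C) w y = cap i &
   \sum_x w x = \sum_(C in P) \sum_(y in C) w y].
Proof.
have [w [w0 wcap wsat]] := @saturated_weights R X _ ord0 cl cap cl_refl cl_eq cap0.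
pose sat x i := \sum_(y | cl i x y) w y == cap i.
have satP x : exists i, sat x i by have [i /eqP hi] := wsat x; exists i.
have /choice[lev hlev] : forall x, exists i, sat x i /\ forall j, sat x j -> (i <= j)%N.
  move=> x; have [i hi] := satP x.
  by case: (@arg_minnP _ i (sat x) (@nat_of_ord _) hi) => m h1 h2; exists m.
have sat_cl i x y : cl i x y -> sat x i = sat y i.
  move=> h; rewrite /sat; congr (_ == _); apply: eq_bigl => z; exact: cl_eq.
have clC i x y : cl i x y -> cl i y x by move=> h; rewrite -(cl_eq _ _ _ _ h) cl_refl.
have lev_eq x y : cl (lev x) x y -> lev y = lev x.
  move=> h; have [sx mx] := hlev x; have [sy my] := hlev y.
  have yx : (lev y <= lev x)%N by apply: my; rewrite -(sat_cl _ _ _ h).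
  apply/val_inj/eqP; rewrite eqn_leq yx/=; apply: mx.
  by rewrite (sat_cl _ _ y)//; exact: cl_nested h.
pose Cl x := [set y | cl (lev x) x y]%SET.
have Cl_eq x y : y \in Cl x -> Cl y = Cl x.
  rewrite inE => h; apply/setP => z; rewrite !inE (lev_eq _ _ h).
  by rewrite (cl_eq _ _ _ _ h).
pose P := [set Cl x | x in X]%SET.
have tP : finset.trivIset P.
  apply/finset.trivIsetP => _ _ /imsetP[x _ ->] /imsetP[y _ ->] ne.
  rewrite -setI_eq0; apply/eqP/setP => z; rewrite finset.in_setI finset.in_set0.
  apply/negP => /andP[/Cl_eq zx /Cl_eq zy].
  by move: ne; rewrite -zx -zy eqxx.
have cP : finset.cover P = [set: X]%SET.
  apply/setP => x; rewrite finset.in_setT; apply/finset.bigcupP.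
  by exists (Cl x); [exact: imset_f|rewrite inE cl_refl].
exists w, P; split => //.
  move=> _ /imsetP[x _ ->]; exists (lev x), x; split => //.
  have [/eqP sx _] := hlev x; rewrite -sx.
  by apply: eq_bigl => y; rewrite inE.
have <- : \sum_(x in finset.cover P) w x = \sum_(C in P) \sum_(y in C) w y.
  exact: finset.big_trivIset.
by rewrite cP; apply: eq_bigl => x; rewrite finset.in_setT.
Qed.

End frostman_tree.

Section diameter.
Variables (R : realType) (d : nat).
Implicit Types (U : set 'rV[R]_d) (x y : 'rV[R]_d).

Lemma enorm_le x (h : R) : 0 <= h -> (forall i, `|x ord0 i| <= h) ->
  enorm x <= Num.sqrt d%:R * h.
Proof.
move=> h0 hx; rewrite /enorm -[h in leRHS]ger0_norm// -sqrtr_sqr -sqrtrM// ler_wsqrtr//.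
apply: (@le_trans _ _ (\sum_(i < d) h ^+ 2)).
  by apply: ler_sum => i _; rewrite -real_normK ?num_real// ler_sqr ?nnegrE.
by rewrite sumr_const card_ord mulr_natl.
Qed.

Lemma ediam_le U (h : R) : 0 <= h ->
  (forall x y, U x -> U y -> forall i, `|x ord0 i - y ord0 i| <= h) ->
  (ediam U <= (Num.sqrt d%:R * h)%:E)%E.
Proof.
move=> h0 hU; apply: ge_ereal_sup => _ [[x y] [/= Ux Uy] <-].
by rewrite lee_fin; apply: enorm_le => // i; rewrite !mxE; exact: hU.
Qed.

Lemma ediam_pow_ge0 (s : R) U : (0 <= ediam_pow s U)%E.
Proof. by rewrite /ediam_pow; case: ifP => // _; exact: poweR_ge0. Qed.

Lemma ediam_pow_le (s : R) U (h : R) : 0 <= s -> 0 <= h ->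
  (forall x y, U x -> U y -> forall i, `|x ord0 i - y ord0 i| <= h) ->
  (ediam_pow s U <= ((Num.sqrt d%:R * h) `^ s)%:E)%E.
Proof.
move=> s0 h0 hU; rewrite /ediam_pow; case: ifPn => [_|/set0P[x Ux]].
  by rewrite lee_fin powR_ge0.
have e0 : (0 <= ediam U)%E.
  apply: ereal_sup_ubound; exists (x, x) => //=.
  rewrite subrr /enorm big1 ?sqrtr0// => i _; by rewrite mxE expr0n.
rewrite -poweR_EFin; apply: gt0_ler_poweR => //.
- by rewrite in_itv/= e0 leey.
- by rewrite in_itv/= leey andbT lee_fin mulr_ge0.
- exact: ediam_le.
Qed.

(** A finite cover, padded with empty sets, competes in the definition of the
    premeasure. *)
Lemma premeasure_le (s delta : R) (E : set 'rV[R]_d) (us : seq (set 'rV[R]_d)) :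
  (forall x, E x -> exists2 U, U \in us & U x) ->
  (forall U, U \in us -> (ediam U <= delta%:E)%E) ->
  (hausdorff_premeasure s delta E <= \sum_(U <- us) ediam_pow s U)%E.
Proof.
move=> cov dia; apply: ereal_inf_lbound; exists (fun k => nth set0 us k).
  split.
    move=> x /cov[U Us Ux]; exists (index U us) => //=; by rewrite nth_index.
  move=> k; have [ks|ks] := ltnP k (size us); first by apply: dia; rewrite mem_nth.
  rewrite nth_default//; apply: ge_ereal_sup => _ [[x y] [/= []]].
rewrite (nneseries_split 0 (size us)); last by move=> k _; exact: ediam_pow_ge0.
rewrite add0n [X in (_ + X)%E]eseries0 ?adde0; last first.
  by move=> k ks _; rewrite nth_default// /ediam_pow eqxx.
by rewrite [in RHS](big_nth set0).
Qed.

Lemma hausdorff_measure_neq0 (s : R) (E : set 'rV[R]_d) :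
  hausdorff_measure s E <> 0%E ->
  exists delta c : R, [/\ 0 < delta, 0 < c & (c%:E <= hausdorff_premeasure s delta E)%E].
Proof.
move=> hE; apply: contrapT => no; apply: hE.
have pre0 delta : (0 <= hausdorff_premeasure s delta E)%E.
  apply/ereal_infP => _ [U _ <-]; apply: nneseries_ge0 => k _ _; exact: ediam_pow_ge0.
have pz delta : 0 < delta -> hausdorff_premeasure s delta E = 0%E.
  move=> d0; apply/eqP; rewrite eq_le pre0 andbT leNgt; apply/negP => h.
  apply: no; move: h; case e : (hausdorff_premeasure s delta E) => [r||] // h.
    by exists delta, r; split; rewrite ?e.
  by exists delta, 1; split; rewrite ?e ?leey.
apply/eqP; rewrite eq_le; apply/andP; split.
  by apply: ge_ereal_sup => _ [delta d0 <-]; rewrite pz.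
by apply: ereal_sup_ubound; exists 1 => //=; rewrite pz.
Qed.

End diameter.

(** * Frostman weights on finite subsets of E *)

Lemma trunc_eq_le (R : realType) (j l : nat) (x y : R) : 0 <= x -> 0 <= y -> (j <= l)%N ->
  Num.trunc (2 ^+ l * x) = Num.trunc (2 ^+ l * y) ->
  Num.trunc (2 ^+ j * x) = Num.trunc (2 ^+ j * y).
Proof.
move=> x0 y0; elim: l => [|l IH]; first by rewrite leqn0 => /eqP ->.
by rewrite leq_eqVlt => /orP[/eqP ->//|/IH h] /trunc_eq_pred; move/(_ x0 y0).
Qed.

Lemma trunc_eq_dist (R : realType) (l : nat) (x y : R) : 0 <= x -> 0 <= y ->
  Num.trunc (2 ^+ l * x) = Num.trunc (2 ^+ l * y) -> `|x - y| <= (2 ^+ l)^-1.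
Proof.
move=> x0 y0 h; have t0 : 0 < 2 ^+ l :> R by rewrite exprn_gt0.
have := truncn_itv (mulr_ge0 (ltW t0) x0); have := truncn_itv (mulr_ge0 (ltW t0) y0).
rewrite h -natr1 => /andP[h1 h2] /andP[h3 h4].
rewrite -(ler_pM2l t0) divff ?gt_eqF// -[in leLHS](gtr0_norm t0) -normrM.
by rewrite ler_norml; apply/andP; split; rewrite mulrBr; lra.
Qed.

Section discrete_frostman.
Variables (R : realType) (d : nat) (E : set 'rV[R]_d) (s : R) (D0 : nat).
Hypothesis d0 : (0 < d)%N.
Hypothesis s0 : 0 < s.
Hypothesis ED : forall x, E x -> forall i, `|x ord0 i| < D0%:R.

Let D := (2 * D0)%N.
Let tau : R := 2 `^ (- s).
Let sh (x : 'rV[R]_d) (i : 'I_d) : R := x ord0 i + D0%:R.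
Let cE (j : nat) (x : 'rV[R]_d) (i : 'I_d) : nat := Num.trunc (2 ^+ j * sh x i).

Let sh0 x i : E x -> 0 <= sh x i.
Proof. by move=> /ED/(_ i); rewrite ltr_norml /sh => /andP[? _]; lra. Qed.

Let shD x i : E x -> sh x i < D%:R.
Proof.
by move=> /ED/(_ i); rewrite ltr_norml /sh /D natrM => /andP[_ ?]; lra.
Qed.

Let cE_lt j x i : E x -> (cE j x i < D * 2 ^ j)%N.
Proof.
move=> Ex; have t0 : 0 < 2 ^+ j :> R by rewrite exprn_gt0.
rewrite /cE truncn_lt_nat ?mulr_ge0 ?sh0 ?(ltW t0)// natrM natrX mulrC.
by rewrite ltr_pM2r// shD.
Qed.

Let tau0 : 0 < tau. Proof. by rewrite powR_gt0. Qed.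

Let tauE j : tau ^+ j = ((2 ^+ j)^-1) `^ s.
Proof.
rewrite -powR_mulrn ?(ltW tau0)// /tau -powRrM mulNr mulrC -mulNr.
by rewrite powRrM powRN powR_mulrn.
Qed.

Let tau1 : tau < 1.
Proof.
by rewrite /tau powRN invf_lt1 ?powR_gt0// /powR pnatr_eq0 expR_gt1 mulr_gt0 ?ln_gt0 ?ltr1n.
Qed.

Let tau_le (j l : nat) : (j <= l)%N -> tau ^+ l <= tau ^+ j.
Proof. by move=> jl; apply: ler_wiXn2l => //; exact: ltW. Qed.

(** One point of E is chosen in each nonempty cube at the finest level, and the tree
    is that of the dyadic cubes of side at most 2^-j0.  The partition into saturated
    cubes gives a cover of E by sets of small diameter, which the positivity of the
    premeasure forces to have a large sum of capacities.  Coordinates are shifted by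
    D0 to make them nonnegative. *)
Lemma discrete_frostman : hausdorff_measure s E <> 0%E ->
  exists A c : R, [/\ 0 <= A, 0 < c & forall l, exists (X : finType) (pt : X -> 'rV[R]_d)
    (w : X -> R), [/\ forall x, E (pt x), forall x, 0 <= w x, c <= \sum_x w x <= A &
    forall j x0, (j <= l)%N ->
      \sum_(y | [forall i, cell R X d (fun x => sh (pt x)) j y i ==
                          cell R X d (fun x => sh (pt x)) j x0 i]) w y <= A * tau ^+ j]].
Proof.
move=> /hausdorff_measure_neq0[delta [c0 [delta0 c00 hc0]]].
pose sd : R := Num.sqrt d%:R.
have sd0 : 0 < sd by rewrite sqrtr_gt0 ltr0n.
(* cubes of side 2^-j0 have diameter at most delta *)
pose j0 := (Num.trunc (sd / delta)).+1.
have hj0 : sd * (2 ^+ j0)^-1 <= delta.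
  rewrite ler_pdivrMr ?exprn_gt0// mulrC -ler_pdivrMr//.
  apply: (@le_trans _ _ j0%:R); first by apply: ltW; exact: truncnS_gt.
  by rewrite -natrX ler_nat ltnW// ltn_expl.
pose M0 := (D * 2 ^ j0)%N.
pose Cd : R := sd `^ s.
have Cd0 : 0 < Cd by rewrite powR_gt0.
(* M0^d bounds the total mass, hence that of the cubes coarser than 2^-j0; the
   summand 1 takes care of the finer ones *)
pose A : R := (M0 ^ d)%:R + 1.
have A1 : 1 <= A by rewrite lerDr.
exists A, (c0 / Cd); split; first exact: le_trans A1.
  by rewrite divr_gt0.
move=> l; pose L := (j0 + l)%N; pose M := (D * 2 ^ L)%N.
pose PX (v : {ffun 'I_d -> 'I_M}) := `[< exists e, E e /\ forall i, cE L e i = v i >].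
pose X : finType := {v : {ffun 'I_d -> 'I_M} | PX v}.
have /choice[pt hpt] : forall x : X, exists e, E e /\ forall i, cE L e i = val x i.
  by move=> x; have /asboolP := valP x.
have Ept x : E (pt x) by have [] := hpt x.
have ptX e : E e -> exists x : X, forall i, cE L e i = cE L (pt x) i.
  move=> Ee; pose v : {ffun 'I_d -> 'I_M} := [ffun i => Ordinal (cE_lt L e i Ee)].
  have Pv : PX v by apply/asboolP; exists e; split => // i; rewrite ffunE.
  exists (exist _ v Pv : X) => i; have [_ ->] := hpt (exist _ v Pv).
  by rewrite /= ffunE.
have cE_le (j l' : nat) x y i : E x -> E y -> (j <= l')%N -> cE l' x i = cE l' y i ->
    cE j x i = cE j y i.
  by move=> Ex Ey; apply: trunc_eq_le; exact: sh0.
pose cl (i : 'I_l.+1) : rel X := fun x y =>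
  [forall k, cE (j0 + i) (pt y) k == cE (j0 + i) (pt x) k].
pose cap (i : 'I_l.+1) : R := tau ^+ (j0 + i).
have clP (i : 'I_l.+1) x y :
    reflect (forall k, cE (j0 + i) (pt y) k = cE (j0 + i) (pt x) k) (cl i x y).
  by apply: (iffP forallP) => h k; exact/eqP/h.
have [|||i|w [P [w0 wcap covP hP sumP]]] := @tree_frostman R X l cl cap.
- by move=> i x; apply/clP.
- move=> i x y z /clP h; apply/clP/clP => h' k; first by rewrite h' h.
  by rewrite h' h.
- move=> i j x y ij /clP h; apply/clP => k; apply: cE_le (h k) => //.
  by rewrite leq_add2l.
- by rewrite exprn_ge0// ltW.
exists X, pt, w.
have mass_j0 (x : X) : \sum_(y | [forall k, cE j0 (pt y) k == cE j0 (pt x) k]) w y <= tau ^+ j0.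
  have := wcap ord0 x; rewrite /cap /cl; by rewrite addn0.
have Wle : \sum_x w x <= (M0 ^ d)%:R * tau ^+ j0.
  pose key (x : X) : {ffun 'I_d -> 'I_M0} := [ffun i => Ordinal (cE_lt j0 (pt x) i (Ept x))].
  rewrite (partition_big key predT)//=.
  apply: (@le_trans _ _ (\sum_(v : {ffun 'I_d -> 'I_M0}) tau ^+ j0)); last first.
    by rewrite sumr_const card_ffun !card_ord -[leLHS]mulr_natl.
  apply: ler_sum => v _.
  have [x /eqP <-|no] := pickP (fun x => key x == v); last first.
    by rewrite big_pred0// exprn_ge0// ltW.
  apply: le_trans (mass_j0 x); rewrite le_eqVlt; apply/orP; left; apply/eqP.
  apply: eq_bigl => y; apply/eqP/forallP => [e k|h].
    have /(congr1 val) := congr1 (fun f : {ffun 'I_d -> 'I_M0} => f k) e.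
    by rewrite !ffunE /= => ->.
  by apply/ffunP => k; apply: val_inj; rewrite !ffunE/=; exact/eqP/h.
have WA : \sum_x w x <= A.
  apply: (le_trans Wle); apply: (@le_trans _ _ (M0 ^ d)%:R); last by rewrite lerDl.
  by rewrite ler_piMr// exprn_ile1// ltW.
split => //.
- apply/andP; split => //.
  have /choice[z hz] : forall C : {set X}, exists iz : 'I_l.+1 * 'rV[R]_d, C \in P ->
      exists x, [/\ C = [set y | cl iz.1 x y]%SET, \sum_(y in C) w y = cap iz.1 & pt x = iz.2].
    move=> C; have [/hP[i [x [h1 h2]]]|_] := boolP (C \in P); last by exists (ord0, 0).
    by exists (i, pt x) => _; exists x.
  (* the part of E in the cube that cuts out the block C of the partition *)
  pose U (C : {set X}) : set 'rV[R]_d :=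
    [set e | E e /\ forall k, cE (j0 + (z C).1) e k = cE (j0 + (z C).1) (z C).2 k].
  have Udiam C x y : U C x -> U C y -> forall i, `|x ord0 i - y ord0 i| <= (2 ^+ (j0 + (z C).1))^-1.
    move=> [Ex hx] [Ey hy] i.
    have -> : x ord0 i - y ord0 i = sh x i - sh y i by rewrite /sh; ring.
    by apply: trunc_eq_dist; rewrite ?sh0//; have := hx i; rewrite -(hy i).
  rewrite ler_pdivrMr// -lee_fin.
  apply: (le_trans hc0).
  apply: (le_trans (@premeasure_le R d s delta E [seq U C | C <- enum P] _ _)).
  + move=> e Ee; have [x hx] := ptX e Ee.
    have : x \in finset.cover P by rewrite covP finset.in_setT.
    move=> /finset.bigcupP[C CP xC]; exists (U C); first by rewrite map_f// mem_enum.
    split => // k.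
    have [y [eC _ py]] := hz C CP.
    have /clP h : cl (z C).1 y x by move: xC; rewrite {1}eC inE.
    rewrite -py -(h k); apply: cE_le (hx k) => //.
    by rewrite leq_add2l -ltnS.
  + move=> _ /mapP[C _ ->].
    apply: le_trans (ediam_le _ _ _ _ _ (Udiam C)) _; first by rewrite invr_ge0 exprn_ge0.
    rewrite lee_fin; apply: le_trans hj0; rewrite ler_pM2l//.
    by rewrite lef_pV2 ?posrE ?exprn_gt0// ler_weXn2l// ?ler1n// leq_addr.
  rewrite big_map sumP -big_enum/= mulr_suml -sumEFin.
  rewrite big_seq [leRHS]big_seq; apply: lee_sum => C; rewrite mem_enum => CP.
  apply: le_trans (ediam_pow_le _ _ _ _ _ _ _ (Udiam C)) _; first exact: ltW.
    by rewrite invr_ge0 exprn_ge0.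
  rewrite lee_fin powRM ?sqrtr_ge0 ?invr_ge0 ?exprn_ge0// -tauE.
  by have [y [_ -> _]] := hz C CP; rewrite mulrC.
- move=> j x0 jl.
  have A0 : 0 <= A by exact: le_trans A1.
  have [jj|jj] := leqP j0 j.
    have hi : (j - j0 < l.+1)%N by rewrite ltnS (leq_trans _ jl)// leq_subr.
    have := wcap (Ordinal hi) x0; rewrite /cap/= subnKC// => h.
    apply: (@le_trans _ _ (tau ^+ j)); last by rewrite ler_peMl// exprn_ge0// ltW.
    apply: le_trans h; rewrite le_eqVlt; apply/orP; left; apply/eqP.
    by apply: eq_bigl => y; rewrite /cl /= subnKC.
  apply: (@le_trans _ _ (\sum_x w x)).
    by rewrite [leRHS](bigID (fun y => [forall i, cell R X d (fun x => sh (pt x)) j y i ==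
                          cell R X d (fun x => sh (pt x)) j x0 i]))/= lerDl sumr_ge0.
  apply: (le_trans Wle); apply: (@le_trans _ _ ((M0 ^ d)%:R * tau ^+ j)).
    by rewrite ler_wpM2l// tau_le// ltnW.
  by apply: ler_wpM2r; [rewrite exprn_ge0// ltW|rewrite lerDl].
Qed.

End discrete_frostman.

(** * Positive measure of the distance set of chains *)

Lemma enorm_ge0 (R : realType) (d : nat) (x : 'rV[R]_d) : 0 <= enorm x.
Proof. exact: sqrtr_ge0. Qed.

Lemma sqr_enorm (R : realType) (d : nat) (x : 'rV[R]_d) :
  enorm x ^+ 2 = \sum_i x ord0 i ^+ 2.
Proof. by rewrite sqr_sqrtr// sumr_ge0// => i _; exact: sqr_ge0. Qed.

Lemma enormN (R : realType) (d : nat) (x : 'rV[R]_d) : enorm (- x) = enorm x.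
Proof. by rewrite /enorm; congr Num.sqrt; apply: eq_bigr => i _; rewrite mxE sqrrN. Qed.

Lemma compact_coord_bounded (R : realType) (d : nat) (E : set 'rV[R]_d) : compact E ->
  exists D0 : nat, (0 < D0)%N /\ forall x, E x -> forall i, `|x ord0 i| < D0%:R.
Proof.
move=> /compact_bounded[B [_ hB]].
exists (Num.trunc (B + 1)).+1; split => // x Ex i.
apply: (@le_lt_trans _ _ (B + 1)); last exact: truncnS_gt.
apply: (@le_trans _ _ `|x|); last by apply: hB => //; rewrite ltrDl.
by rewrite [leRHS]/Num.norm /= mx_normrE; apply/bigmax_geP; right => /=; exists (ord0, i).
Qed.

(** Below the dimension, which is an infimum, no exponent gives measure 0. *)
Lemma exists_dim_between (R : realType) (d : nat) (E : set 'rV[R]_d) (a : R) : 0 <= a ->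
  (a%:E < hausdorff_dim E)%E -> exists s : R, a < s /\ hausdorff_measure s E <> 0%E.
Proof.
move=> a0 h.
have [s [as_ sdim]] : exists s : R, a < s /\ (s%:E < hausdorff_dim E)%E.
  move: h; case: (hausdorff_dim E) => [r| |] // h.
    rewrite lte_fin in h; exists ((a + r) / 2); rewrite lte_fin; split; lra.
  by exists (a + 1); rewrite ltrDl ltr01 ltey.
exists s; split => // hs; move: sdim; rewrite ltNge => /negP; apply.
apply: ereal_inf_lbound; exists s => //=; split => //.
by apply: ltW; exact: le_lt_trans as_.
Qed.

(** This is where the threshold (d+1)/2 enters: with tau = 2^-s, it is the
    convergence of the sum of 2^j 2^(jd) tau^(2j). *)
Lemma powR2N_lt1 (R : realType) (d : nat) (s : R) : (d%:R + 1) / 2 < s ->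
  2 ^+ d.+1 * (2 `^ (- s)) ^+ 2 < 1 :> R.
Proof.
move=> h; rewrite -(powR_mulrn d.+1)// -(powR_mulrn 2) ?powR_ge0// -powRrM.
rewrite -powRD; last by rewrite pnatr_eq0 implybT.
rewrite /powR pnatr_eq0 expR_lt1 -natr1.
by rewrite nmulr_rlt0 ?ln_gt0 ?ltr1n//; lra.
Qed.

Theorem corollary1p9 (R : realType) (d k : nat) (hd : (2 <= d)%N) (hk : (1 <= k)%N)
  (E : set 'rV[R]_d) (hE : compact E)
  (hdim : (((d%:R + 1) / 2 : R)%:E < hausdorff_dim E)%E) :
  (0 < lebesgue_tuple k (chain_distances k E))%E.
Proof.
have d0 : (0 < d)%N by exact: ltn_trans hd.
have [D0 [D00 ED]] := compact_coord_bounded _ _ _ hE.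
have [s [ds Hs]] : exists s : R, (d%:R + 1) / 2 < s /\ hausdorff_measure s E <> 0%E.
  by apply: exists_dim_between => //; rewrite divr_ge0// addr_ge0.
have s0 : 0 < s by apply: le_lt_trans ds; rewrite divr_ge0// addr_ge0.
pose tau : R := 2 `^ (- s).
have tau0 : 0 < tau by rewrite powR_gt0.
have tau1 : 2 ^+ d.+1 * tau ^+ 2 < 1 by exact: powR2N_lt1.
have [A [c [A0 c0 hA]]] := @discrete_frostman R d E s D0 d0 s0 ED Hs.
pose D := (2 * D0)%N.
have Dpos : (0 < D)%N by rewrite muln_gt0.
have dR : 1 <= d%:R :> R by rewrite ler1n.
pose C : R := 8 * collision_const R d D tau A + 1.
have C0 : 0 < C by rewrite ltr_wpDl// mulr_ge0// collision_const_ge0.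
have dist_le x y : E x -> E y -> enorm (x - y) <= d%:R * D%:R.
  move=> /ED Ex /ED Ey; apply: (@le_trans _ _ (Num.sqrt d%:R * D%:R)).
    apply: enorm_le => // i; rewrite !mxE natrM.
    have := Ex i; have := Ey i; have := ler_normB (x ord0 i) (y ord0 i); lra.
  rewrite ler_wpM2r// -[leRHS]ger0_norm// -sqrtr_sqr ler_wsqrtr//.
  by rewrite expr2 ler_peMl.
pose c' : R := c ^+ k.*2 / C ^+ k.
have c'0 : 0 < c' by rewrite divr_gt0// exprn_gt0.
apply: (@lt_le_trans _ _ c'%:E); first by rewrite lte_fin.
apply: (@lebesgue_tuple_ge R k _ c' (d%:R * D%:R + 1)).
- by rewrite addr_gt0// mulr_gt0// ltr0n.
- move=> _ [x Ex <-] i; rewrite tnth_mktuple enorm_ge0/=.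
  by rewrite (le_lt_trans (dist_le _ _ (Ex _) (Ex _)))// ltrDl.
- move=> t tp ht.
  have [|x [Ex hx]] := @chain_distances_closed R d k E (tnth t) hE.
    move=> eps eps0; pose l := (Num.trunc eps^-1).+1.
    have [_ [x Ex <-] hx] := ht l.
    exists x; split => // i.
    have := hx i; rewrite tnth_mktuple => /trunc_eq_dist; move/(_ (tp i) (enorm_ge0 _ _ _)).
    move/le_trans; apply; rewrite invf_ple ?posrE ?exprn_gt0//.
    apply: (@le_trans _ _ l%:R); first by apply: ltW; exact: truncnS_gt.
    by rewrite -natrX ler_nat ltnW// ltn_expl.
  by exists x => //; apply: eq_from_tnth => i; rewrite tnth_mktuple hx.
move=> l.
have [X [pt [w [Ept w0 /andP[cW WA] mass]]]] := hA l.
pose q x y := Num.trunc (2 ^+ l * enorm (pt x - pt y)).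
pose Q := (\max_x \max_y q x y).+1.
have qQ x y : (q x y < Q)%N.
  by rewrite ltnS (leq_trans _ (leq_bigmax x))// (leq_bigmax y).
pose p x (i : 'I_d) : R := pt x ord0 i + D0%:R.
have p0 x i : 0 <= p x i.
  by have := ED _ (Ept x) i; rewrite ltr_norml /p => /andP[? _]; lra.
have pD x i : p x i < D%:R.
  by have := ED _ (Ept x) i; rewrite ltr_norml /p natrM => /andP[_ ?]; lra.
have sqE x y : \sum_i (p x i - p y i) ^+ 2 = enorm (pt x - pt y) ^+ 2.
  by rewrite sqr_enorm; apply: eq_bigr => i _; rewrite !mxE /p; congr (_ ^+ 2); ring.
have t0 : 0 < 2 ^+ l :> R by rewrite exprn_gt0.
pose kappa : R := C / 2 ^+ l.
have kappa0 : 0 <= kappa by rewrite divr_ge0 ?ltW.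
have coll (f : X -> R) : (forall x, 0 <= f x) ->
  \sum_y w y * (\sum_x \sum_x' (w x * f x) * (w x' * f x') * (q x y == q x' y)%:R)
  <= kappa * \sum_x w x * f x ^+ 2.
  move=> f0; apply: le_trans (@collision_bound R X d D l w p tau A w0 d0 Dpos p0 pD
    A0 tau0 tau1 WA mass f q f0 _) _.
    move=> x x' y qxy; rewrite !sqE.
    have h := trunc_eq_dist _ _ _ _ (enorm_ge0 _ _ _) (enorm_ge0 _ _ _) qxy.
    rewrite subr_sqr normrM.
    set a := enorm (pt x - pt y) in h *; set b := enorm (pt x' - pt y) in h *.
    have hab : `|a + b| <= 2 * (d%:R * D%:R).
      rewrite ger0_norm ?addr_ge0 ?enorm_ge0//.
      have := dist_le _ _ (Ept x) (Ept y); have := dist_le _ _ (Ept x') (Ept y).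
      rewrite -/a -/b; lra.
    apply: (@le_trans _ _ (2 ^+ l * ((4 * d%:R * D%:R)^-1 * ((2 ^+ l)^-1 * (2 * (d%:R * D%:R)))))).
      by rewrite ler_wpM2l ?(ltW t0)// ler_wpM2l ?invr_ge0 ?mulr_ge0// ler_pM.
    rewrite (_ : _ * _ = 1 / 2); first lra.
    by field; rewrite !pnatr_eq0 -!lt0n d0 Dpos gt_eqF.
  apply: ler_wpM2r; first exact: sum_wsqr_ge0.
  by rewrite /kappa ler_pM2r ?invr_gt0// /C lerDl.
have W0 : 0 < \sum_x w x by exact: lt_le_trans cW.
have many := @many_realised R X w q Q kappa w0 qQ kappa0 coll k W0.
exists (realised R X w q Q k); split.
- by apply: filter_uniq; exact: vectors_uniq.
- move=> v /(realisedP _ _ _ _ _ w0)[sv [ch hch]]; split => //.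
  exists [tuple enorm (pt (ch (@inord k i)) - pt (ch (@inord k i.+1))) | i < k].
    by exists (fun i : 'I_k.+1 => pt (ch i)).
  move=> i; have i1 : (i < k.+1)%N by rewrite ltnS ltnW.
  have i2 : (i.+1 < k.+1)%N by rewrite ltnS.
  by rewrite tnth_mktuple -hch// /q -enormN opprB !inordK.
- rewrite -(ler_pM2r (exprn_gt0 k C0)).
  have -> : c' * 2 ^+ (l * k) * C ^+ k = c ^+ k.*2 * (2 ^+ l) ^+ k.
    by rewrite /c' exprM; field; rewrite gt_eqF// exprn_gt0.
  have -> : C ^+ k = kappa ^+ k * (2 ^+ l) ^+ k.
    by rewrite -exprMn /kappa divfK// gt_eqF.
  rewrite mulrA ler_pM2r ?exprn_gt0//; apply: le_trans many.
  by rewrite ler_pXn2r ?nnegrE ?(ltW c0) ?(ltW W0)// double_gt0.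
Qed.
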